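(* Let $\{X(t)\}_{t\ge 0}$ be the real-valued Lévy process with $\mathbb{E}[e^{iyX(t)}]=\exp(t\psi(y))$ for all $t\ge0$, $y\in\mathbb{R}$, where $$\psi(y)=\int_{0+}^\infty \left(e^{iyx}-1-iyx\,1_{\{x\le 1\}}\right)d\phi(x)$$ and the Lévy measure $\phi$ is concentrated on $\{2^k:k\in\mathbb{Z}\}$ with $\phi(\{2^k\})=2^{-k}$. For $t\in[\frac12,1]$ let $Y(t)=t^{-1}(X(t)-t\log_2 t)$, and let $G_Y([\frac12,1])=\{(t,Y(t)):t\in[\frac12,1]\}\subseteq\mathbb{R}^2$ be the graph. Then almost surely $$\dim_{\rm H} G_Y([\tfrac12,1])\le 1.$$
   Context: $\dim_{\rm H}$ denotes Hausdorff dimension. $\log_2$ is the logarithm to base $2$. Explicitly, $\psi(y)=\sum_{k\in\mathbb{Z}}2^{-k}\left(e^{iy2^k}-1-iy2^k1_{\{k\le 0\}}\right)$. A Lévy process starts at $0$, has stationary independent increments and càdlàg sample paths. *)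

(* Defs.v *)
From HB Require Import structures.
From mathcomp Require Import all_boot all_order all_algebra.
From mathcomp Require Import all_classical all_reals all_analysis.
From mathcomp Require Import complex.

Set Implicit Arguments.
Unset Strict Implicit.
Unset Printing Implicit Defensive.

Import Order.TTheory GRing.Theory Num.Theory.
Import numFieldNormedType.Exports.

Local Open Scope classical_set_scope.
Local Open Scope ring_scope.
Local Open Scope complex_scope.

Section complex_valued.
Variable R : realType.

Definition cexp (z : R[i]) : R[i] :=
  (expR (complex.Re z) * cos (complex.Im z))
    +i* (expR (complex.Re z) * sin (complex.Im z)).

(* Meaningful when the real and imaginary parts are integrable: [Rintegral]
   takes a default value otherwise. *)
Definition cintegral (d : measure_display) (T : measurableType d)
    (mu : {measure set T -> \bar R}) (D : set T) (f : T -> R[i]) : R[i] :=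
  (Rintegral mu D (fun x => complex.Re (f x)))
    +i* (Rintegral mu D (fun x => complex.Im (f x))).

Definition char_fun (d : measure_display) (T : measurableType d)
    (P : probability T R) (X : T -> R) (y : R) : R[i] :=
  cintegral P setT (fun w => cexp ('i * (y * X w)%:C)).

Definition levy_exponent (phi : {measure set R -> \bar R}) (y : R) : R[i] :=
  cintegral phi `]0, +oo[
    (fun x => cexp ('i * (y * x)%:C) - 1
              - 'i * (y * x)%:C * (\1_[set z : R | z <= 1] x)%:C).

End complex_valued.

Section levy_process.
Variables (R : realType) (d : measure_display) (T : measurableType d).
Variable P : probability T R.

(* The time set is [0, +oo[: [X t] is unconstrained for [t < 0]. *)
Definition real_process (X : R -> T -> R) :=
  forall t, 0 <= t -> measurable_fun [set: T] (X t).

Definition increment (X : R -> T -> R) (s t : R) (w : T) : R := X t w - X s w.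

(* Mutual independence of a finite family of real random variables; taking
   [B i = setT] for some indices gives the product rule for subfamilies. *)
Definition mutually_independent (n : nat) (Z : 'I_n -> T -> R) :=
  forall B : 'I_n -> set R, (forall i, measurable (B i)) ->
    P (\bigcap_(i in [set: 'I_n]) (Z i @^-1` B i))
    = (\prod_(i < n) P (Z i @^-1` B i))%E.

Definition independent_increments (X : R -> T -> R) :=
  forall (n : nat) (t : nat -> R),
    0 <= t 0%N -> (forall i, (i < n)%N -> t i <= t i.+1) ->
    mutually_independent (fun i : 'I_n => increment X (t i) (t i.+1)).

Definition stationary_increments (X : R -> T -> R) :=
  forall s h : R, 0 <= s -> 0 <= h ->
    forall B : set R, measurable B ->
      P (increment X s (s + h) @^-1` B) = P (increment X 0 h @^-1` B).

Definition cadlag (f : R -> R) :=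
  (forall t, 0 <= t -> f s @[s --> t^'+] --> f t) /\
  (forall t, 0 < t -> cvg (f s @[s --> t^'-])).

Definition levy_process (X : R -> T -> R) :=
  [/\ real_process X,
      {ae P, forall w, X 0 w = 0},
      independent_increments X,
      stationary_increments X &
      {ae P, forall w, cadlag (fun t => X t w)}].

End levy_process.

Section hausdorff_dimension.
Variable R : realType.
Local Open Scope ereal_scope.

(* The Euclidean distance; the norm of the library on [R * R] is the
   supremum norm. *)
Definition edist2 (p q : R * R) : R :=
  Num.sqrt ((p.1 - q.1) ^+ 2 + (p.2 - q.2) ^+ 2)%R.

Definition diam (U : set (R * R)) : \bar R :=
  ereal_sup [set (edist2 pq.1 pq.2)%:E | pq in U `*` U].

(* The empty set contributes 0, even for [s = 0]; [diam set0] is -oo. *)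
Definition diam_pow (s : R) (U : set (R * R)) : \bar R :=
  if U == set0 then 0 else diam U `^ s.

Definition hausdorff_content (s delta : R) (A : set (R * R)) : \bar R :=
  ereal_inf [set \sum_(0 <= n <oo) diam_pow s (U n) |
    U in [set U : nat -> set (R * R) |
      A `<=` \bigcup_n U n /\ forall n, diam (U n) <= delta%:E]].

Definition hausdorff_measure (s : R) (A : set (R * R)) : \bar R :=
  ereal_sup [set hausdorff_content s delta A | delta in [set e : R | (0 < e)%R]].

Definition hausdorff_dim (A : set (R * R)) : \bar R :=
  ereal_inf [set s%:E | s in [set s : R | (0 <= s)%R /\ hausdorff_measure s A = 0]].

End hausdorff_dimension.

Section graph_of_Y.
Variable R : realType.

Definition log2 (t : R) : R := ln t / ln 2.

Definition Y_of (T : Type) (X : R -> T -> R) (t : R) (w : T) : R :=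
  t^-1 * (X t w - t * log2 t).

Definition graph_on (f : R -> R) (D : set R) : set (R * R) :=
  [set (t, f t) | t in D].

End graph_of_Y.

(* Main.v *)
Require Import Defs.
From HB Require Import structures.
From mathcomp Require Import all_boot all_order all_algebra.
From mathcomp Require Import all_classical all_reals all_analysis.
From mathcomp Require Import measurable_realfun complex.
From mathcomp Require Import ring lra zify.

Set Implicit Arguments.
Unset Strict Implicit.
Unset Printing Implicit Defensive.

Import Order.TTheory GRing.Theory Num.Theory.
Import numFieldNormedType.Exports.

Local Open Scope classical_set_scope.
Local Open Scope ring_scope.
Local Open Scope complex_scope.

(* The exponent satisfies |psi(y)| <= C y (1 + |log y|): of the atoms between
   the scales 1 and 1/y each contributes O(y), and the others contribute
   geometric tails. Summing 1 - Re E[exp(i y X(t))] over y = 2^-l / u for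
   l >= 0 then yields P(|X(t)| >= u) <= C t (1 + |log u|) / u, and Ottaviani's
   inequality turns this into the same bound for the oscillation of X over an
   interval of length t. Hence the mean number of squares of side h = 2^-n
   needed to cover the graph of X over [1/2, 1] is at most of order
   n^2 / h: an interval of length h whose oscillation exceeds 2^k h needs about
   2^k squares, but this happens with probability O(n 2^-k) only, and by
   boundedness of the path no k >= 2n occurs once n is large. So for each s > 1
   the s-dimensional cost of the cover tends to 0 in mean, and by Markov's
   inequality it is almost surely arbitrarily small for suitable n. The map
   (t, x) |-> (t, x / t - log2 t), Lipschitz on bounded sets, transfers the
   cover to the graph of Y. *)

(** * Elementary bounds for sine and cosine *)

Section trigonometric_bounds.
Variable R : realType.
Implicit Types x : R.

Lemma norm_sin_le x : `|sin x| <= `|x|.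
Proof.
have h (y : R) : 0 <= y -> `|sin y| <= y.
  move=> y0.
  have [|c _] := @MVT_segment R sin cos 0 y y0.
    by apply: continuous_subspaceT => t; exact: continuous_sin.
  rewrite sin0 !subr0 => ->; rewrite normrM (ger0_norm y0).
  by rewrite ler_piMl// cos_max.
have [x0|x0] := leP 0 x; first by rewrite (ger0_norm x0) h.
by rewrite -normrN -sinN -(normrN x) (ger0_norm (_ : 0 <= - x)) ?h// lerNr oppr0 ltW.
Qed.

Lemma one_sub_cosE x : 1 - cos x = 2 * sin (x / 2) ^+ 2.
Proof.
have -> : cos x = cos ((x / 2) *+ 2) by congr cos; rewrite -mulr_natr; field.
by rewrite cos_mulr2n sin2cos2; ring.
Qed.

Lemma one_sub_cos_ge0 x : 0 <= 1 - cos x.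
Proof. by rewrite subr_ge0 cos_le1. Qed.

Lemma one_sub_cos_le_sqr x : 1 - cos x <= x ^+ 2 / 2.
Proof.
rewrite one_sub_cosE.
have : sin (x / 2) ^+ 2 <= (x / 2) ^+ 2.
  by rewrite -[leLHS]real_normK ?num_real// -[leRHS]real_normK ?num_real// lerXn2r// ?nnegrE// norm_sin_le.
by rewrite exprMn; lra.
Qed.

Lemma one_sub_cos_le_norm x : 1 - cos x <= `|x|.
Proof.
have [x2|x2] := leP 2 `|x|.
  by apply: (le_trans _ x2); rewrite lerBlDl -lerBlDr; have := cos_geN1 x; lra.
apply: (le_trans (one_sub_cos_le_sqr x)).
rewrite -[x ^+ 2]real_normK ?num_real// expr2 -mulrA ler_piMr//; lra.
Qed.

Lemma norm_sin_sub_le x : `|sin x - x| <= x ^+ 2.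
Proof.
have h (y : R) : 0 <= y -> `|sin y - y| <= y ^+ 2.
  move=> y0.
  have [|c] := @MVT_segment R (fun t => sin t - t) (fun t => cos t - 1) 0 y y0.
    apply: continuous_subspaceT => t.
    by apply: cvgB; [exact: continuous_sin | exact: cvg_id].
  rewrite sin0 !subr0 => /andP[c0 cy] ->; rewrite normrM (ger0_norm y0) expr2.
  rewrite ler_wpM2r// distrC ger0_norm ?one_sub_cos_ge0//.
  by apply: (le_trans (one_sub_cos_le_norm c)); rewrite ger0_norm.
have [x0|x0] := leP 0 x; first exact: h.
have -> : sin x - x = - (sin (- x) - (- x)) by rewrite sinN; ring.
by rewrite normrN -sqrrN h// lerNr oppr0 ltW.
Qed.

Lemma one_sub_cos1_gt0 : 0 < 1 - cos 1 :> R.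
Proof.
by rewrite subr_gt0 -[X in _ < X]cos0 ltr_cos ?ltr01// in_itv/= ?lexx ?pi_ge0// ler01 (le_trans _ (pi_ge2 R))// ler1n.
Qed.

(** Cosine is even and decreases on [0, pi], which contains [1, 2]. In the tail bound this keeps one
    term of a dyadic sum away from 0. *)
Lemma one_sub_cos_ge x : 1 <= `|x| <= 2 -> 1 - cos 1 <= 1 - cos x.
Proof.
move=> /andP[x1 x2]; rewrite lerD2l lerN2 -[in leLHS]cos_norm.
rewrite le_eqVlt; have [->|ne] := eqVneq `|x| 1; first by rewrite eqxx.
apply/orP; right.
rewrite ltr_cos ?in_itv/= ?normr_ge0 ?(le_trans x2 (pi_ge2 R)) ?ler01//.
  by rewrite lt_neqAle eq_sym ne.
by rewrite (le_trans _ (pi_ge2 R))// ler1n.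
Qed.

End trigonometric_bounds.

(** * The Levy exponent at dyadic points *)

Section two_sided_geometric_measure.
Variable R : realType.
Local Open Scope ereal_scope.

Lemma sum_half_pow_le (N : nat) : (\sum_(0 <= j < N) (2^-1 : R) ^+ j <= 2)%R.
Proof.
suff -> : (\sum_(0 <= j < N) (2^-1 : R) ^+ j = 2 - 2 * 2^-1 ^+ N)%R.
  by rewrite gerBl mulr_ge0// exprn_ge0// invr_ge0.
elim: N => [|N IH]; first by rewrite big_nil expr0; ring.
by rewrite big_nat_recr//= IH exprS; field.
Qed.

(** A crude bound for each of the first [m] terms is combined with geometric decay of the rest. It
    serves both halves of the Levy measure and, with [B = 0], finite covers. *)
Lemma nneseries_le_geometric_tail (a : nat -> R) (m : nat) (A B : R) :
  (forall j, 0 <= a j)%R -> (0 <= B)%R ->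
  (forall j, (j < m)%N -> a j <= A)%R ->
  (forall j, a (m + j)%N <= B * 2^-1 ^+ j)%R ->
  \sum_(0 <= j <oo) (a j)%:E <= (m%:R * A + 2 * B)%:E.
Proof.
move=> a0 B0 aA aB; apply: lime_le.
  by apply: is_cvg_nneseries => n _ _; rewrite lee_fin.
apply: nearW => N; rewrite sumEFin lee_fin.
(* Enlarging the partial sum to [m + N] terms lets it be cut at [m] whatever [N] is. *)
apply: (@le_trans _ _ (\sum_(0 <= j < m + N) a j)%R).
  rewrite (@big_cat_nat _ _ _ N 0%N (m + N)%N)//= ?leq_addl//.
  by rewrite lerDl sumr_ge0.
rewrite (@big_cat_nat _ _ _ m 0%N (m + N)%N)//= ?leq_addr//.
apply: lerD.
  apply: (@le_trans _ _ (\sum_(0 <= j < m) A)%R).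
    by rewrite big_nat [leRHS]big_nat; apply: ler_sum => j /= jm; exact: aA.
  by rewrite sumr_const_nat subn0 mulr_natl.
rewrite -[X in (\sum_(X <= _ < _) _)%R]add0n big_addn addKn.
apply: (@le_trans _ _ (\sum_(0 <= j < N) B * 2^-1 ^+ j)%R).
  by apply: ler_sum => j _; rewrite addnC; exact: aB.
by rewrite -mulr_sumr mulrC ler_wpM2r// sum_half_pow_le.
Qed.

Variable phi : {measure set R -> \bar R}.
Hypothesis phi_supp : phi (~` [set ((2 : R) ^ k)%R | k in [set: int]]) = 0.
Hypothesis phi_atom : forall k : int, phi [set ((2 : R) ^ k)%R] = ((2 : R) ^ (- k))%:E.

Lemma integral_phi_set1 (g : R -> \bar R) (k : int) :
  (forall x, 0 <= g x) ->
  \int[phi]_(x in [set ((2 : R) ^ k)%R]) g x = ((2 : R) ^ (- k))%:E * g ((2 : R) ^ k)%R.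
Proof.
move=> g0.
rewrite (@eq_integral _ _ _ phi _ (cst (g ((2 : R) ^ k)%R))); last first.
  by move=> x; rewrite inE/= => ->.
by rewrite integral_cst//= phi_atom muleC.
Qed.

(** The atoms split into the powers with exponent [Posz j] and those with exponent [Negz j], that is
    -(j+1), whence the shift [j.+1] in the second series. *)
Lemma integral_phi_le (D : set R) (g : R -> \bar R) : measurable D ->
  (forall x, 0 <= g x) -> measurable_fun setT g ->
  \int[phi]_(x in D) g x <=
    \sum_(0 <= j <oo) ((2^-1 : R) ^+ j)%:E * g (2 ^+ j)%R
    + \sum_(0 <= j <oo) ((2 : R) ^+ j.+1)%:E * g (2^-1 ^+ j.+1)%R.
Proof.
move=> mD g0 mg.
have gD E : measurable_fun E g by exact: measurable_funS mg.
pose S1 := \bigcup_(j in [set: nat]) [set ((2 : R) ^ (Posz j))%R].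
pose S2 := \bigcup_(j in [set: nat]) [set ((2 : R) ^ (Negz j))%R].
have inj2 (k l : int) : ((2 : R) ^ k = 2 ^ l)%R -> k = l.
  by apply: ieexprIz; rewrite ?ltr0n//; apply/eqP => /(congr1 (fun x : R => x - 1)%R); lra.
have mS1 : measurable S1 by exact: bigcup_measurable.
have mS2 : measurable S2 by exact: bigcup_measurable.
have SE : [set ((2 : R) ^ k)%R | k in [set: int]] = S1 `|` S2.
  apply/seteqP; split=> x /=.
    by case=> -[k|k] _ <-; [left|right]; exists k.
  by case=> -[k _ /= ->]; [exists (Posz k)|exists (Negz k)].
have S12 : [disjoint S1 & S2].
  by apply/disj_setPS => x [[k _ /= ->] [l _ /= /inj2]].
have -> : \sum_(0 <= j <oo) ((2^-1 : R) ^+ j)%:E * g (2 ^+ j)%R = \int[phi]_(x in S1) g x.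
  rewrite ge0_integral_bigcup//.
    apply: eq_eseriesr => j _; rewrite integral_phi_set1//; congr (_%:E * _).
    by rewrite -exprz_inv.
  by move=> i j _ _ [x [/= -> /inj2[]]].
have -> : \sum_(0 <= j <oo) ((2 : R) ^+ j.+1)%:E * g (2^-1 ^+ j.+1)%R = \int[phi]_(x in S2) g x.
  rewrite ge0_integral_bigcup//.
    apply: eq_eseriesr => j _; rewrite integral_phi_set1// NegzE opprK.
    by rewrite exprVn.
  by move=> i j _ _ [x [/= -> /inj2[]]].
rewrite -ge0_integral_setU// -SE.
have mS : measurable [set ((2 : R) ^ k)%R | k in [set: int]] by rewrite SE; exact: measurableU.
(* The complement of the atoms is null: its integral is added for free and completes the domain to
   the whole line, which contains [D]. *)
rewrite -[leRHS]adde0 -(@null_set_integral _ _ _ phi _ g (measurableC mS))//.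
rewrite -ge0_integral_setU//; last by apply/disj_setPS => x [].
  rewrite setUv; apply: ge0_subset_integral => //.
all: try exact: measurableC.
Qed.

End two_sided_geometric_measure.

Section levy_exponent_bound.
Variable R : realType.
Implicit Types x y : R.

(** This is the imaginary part of the integrand of [levy_exponent]. *)
Definition compensated_sin y x := sin (y * x) - y * x * \1_[set z : R | z <= 1] x.

Lemma Re_levy_exponentE (phi : {measure set R -> \bar R}) y :
  complex.Re (levy_exponent phi y) = Rintegral phi `]0, +oo[ (fun x => cos (y * x) - 1).
Proof.
apply: eq_Rintegral => x _; rewrite /cexp /=.
by rewrite !(mul0r, mul1r, mulr0, oppr0, add0r, addr0) expR0 mul1r.
Qed.

Lemma Im_levy_exponentE (phi : {measure set R -> \bar R}) y :
  complex.Im (levy_exponent phi y) = Rintegral phi `]0, +oo[ (compensated_sin y).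
Proof.
apply: eq_Rintegral => x _; rewrite /cexp /compensated_sin /=.
by rewrite !(mul0r, mul1r, mulr0, oppr0, add0r, addr0) expR0 mul1r.
Qed.

(** The integrand is nonpositive, and [fine] sends an infinite integral to 0, so the sign survives
    in every case. *)
Lemma Re_levy_exponent_le0 (phi : {measure set R -> \bar R}) y :
  complex.Re (levy_exponent phi y) <= 0.
Proof.
rewrite Re_levy_exponentE /Rintegral.
under eq_integral do rewrite -opprB EFinN.
rewrite integral_ge0N; last by move=> x _; rewrite lee_fin one_sub_cos_ge0.
rewrite fineN oppr_le0 fine_ge0//.
by apply: integral_ge0 => x _; rewrite lee_fin one_sub_cos_ge0.
Qed.

(** It dominates both the real and the imaginary part of the integrand, so one estimate gives
    integrability and size for both. *)
Definition exponent_majorant y x := (1 - cos (y * x)) + `|compensated_sin y x|.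

Lemma exponent_majorant_ge0 y x : 0 <= exponent_majorant y x.
Proof. by rewrite addr_ge0 ?one_sub_cos_ge0. Qed.

(** Of the three bounds on the majorant, the linear one is for the intermediate scales, the
    quadratic one for small [x], where the compensator acts, and the constant one for large [x]. *)
Lemma exponent_majorant_le_linear y x : 0 <= y -> 0 <= x ->
  exponent_majorant y x <= 3 * (y * x).
Proof.
move=> y0 x0; have yx0 : 0 <= y * x by rewrite mulr_ge0.
have : `|compensated_sin y x| <= 2 * (y * x).
  apply: (le_trans (ler_normB _ _)); have := norm_sin_le (y * x).
  rewrite [X in _ + X <= _]normrM (ger0_norm yx0) => h.
  have : `|\1_[set z : R | z <= 1] x| <= 1 :> R.
    by rewrite indicE normr_nat; case: (_ \in _).
  by move=> /(ler_wpM2l yx0); lra.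
by have := one_sub_cos_le_norm (y * x); rewrite /exponent_majorant (ger0_norm yx0); lra.
Qed.

Lemma exponent_majorant_le_quadratic y x : x <= 1 ->
  exponent_majorant y x <= 2 * (y * x) ^+ 2.
Proof.
move=> x1; rewrite /exponent_majorant /compensated_sin indicE mem_set// mulr1.
have := one_sub_cos_le_sqr (y * x); have := norm_sin_sub_le (y * x).
by have := sqr_ge0 (y * x); lra.
Qed.

Lemma exponent_majorant_le_cst y x : 1 < x -> exponent_majorant y x <= 3.
Proof.
move=> x1; rewrite /exponent_majorant /compensated_sin indicE memNset/=; last first.
  by apply/negP; rewrite -ltNge.
rewrite mulr0 subr0; have := sin_max (y * x); have := cos_geN1 (y * x); lra.
Qed.

Lemma measurable_compensated_sin y : measurable_fun [set: R] (compensated_sin y).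
Proof.
have my : measurable_fun [set: R] (fun x => y * x) by exact: measurable_funM.
apply: measurable_funB.
  apply: (@measurableT_comp _ _ _ _ _ _ sin) => //.
  by apply: continuous_measurable_fun; exact: continuous_sin.
apply: measurable_funM => //; apply: measurable_indic.
by rewrite (_ : [set z | z <= 1] = `]-oo, 1%R]%classic).
Qed.

Lemma measurable_cos_mul y : measurable_fun [set: R] (fun x => cos (y * x)).
Proof.
apply: (@measurableT_comp _ _ _ _ _ _ cos).
  by apply: continuous_measurable_fun; exact: continuous_cos.
exact: measurable_funM.
Qed.

Lemma measurable_exponent_majorant y : measurable_fun [set: R] (exponent_majorant y).
Proof.
apply: measurable_funD.
  by apply: measurable_funB => //; exact: measurable_cos_mul.
apply: (@measurableT_comp _ _ _ _ _ _ (fun z : R => `|z|)) => //.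
exact: measurable_compensated_sin.
Qed.

Variable phi : {measure set R -> \bar R}.
Hypothesis phi_supp : phi (~` [set ((2 : R) ^ k)%R | k in [set: int]]) = 0%E.
Hypothesis phi_atom : forall k : int, phi [set ((2 : R) ^ k)%R] = ((2 : R) ^ (- k))%:E.

(* The [3 y] bound of each of the [|k|] atoms between [1] and [1 / y] is what
   makes the exponent of order [y log (1 / y)]. *)
Lemma integral_exponent_majorant_le (k : int) (y := (2 : R) ^ (- k)) :
  (\int[phi]_(x in `]0%R, +oo[) (exponent_majorant y x)%:E
     <= (11 * y * (`|k|%N%:R + 1))%:E)%E.
Proof.
have y0 : 0 < y by rewrite exprz_gt0.
set m := `|k|%N.
(* Whatever the sign of [k], [y] lies between 2^-m and 2^m, so on both sides of 1 the linear bound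
   can give way to geometric decay after about [m] atoms. *)
have yub : y <= 2 ^+ m.
  by rewrite /y -[2 ^+ m]/(2 ^ Posz m) ler_weXz2l ?ler1n//; lia.
have ylb : (2^-1) ^+ m <= y.
  by rewrite /y -[_ ^+ m]/(_ ^ Posz m) exprz_inv ler_weXz2l ?ler1n//; lia.
apply: (le_trans (integral_phi_le phi_supp phi_atom _ _ _)) => //.
- by move=> x; rewrite lee_fin exponent_majorant_ge0.
- by apply/measurable_EFinP; exact: measurable_exponent_majorant.
have h0 n : 0 < (2^-1 : R) ^+ n by rewrite exprn_gt0// invr_gt0.
have p0 n : 0 < (2 : R) ^+ n by rewrite exprn_gt0.
have hp n : (2^-1 : R) ^+ n * 2 ^+ n = 1 by rewrite -exprMn mulVf// expr1n.
have aux1 (a b : R) : a * (3 * (y * b)) = 3 * y * (a * b) by ring.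
have aux2 (a b : R) : a * (2 * (y * b) ^+ 2) = 2 * y * y * (b * a) * b by ring.
(* The atoms at least 1 cost (3m + 9) y; those below 1 cost (3m + 2) y, and are allotted (8m + 2)
   y. *)
have -> : (11 * y * (m%:R + 1))%:E =
    (((m.+1)%:R * (3 * y) + 2 * (3 * y)) + (8 * (y * m%:R) + 2 * y))%:E :> \bar R.
  by congr EFin; rewrite -natr1; ring.
rewrite EFinD; apply: leeD.
- under eq_eseriesr do rewrite -EFinM.
  apply: nneseries_le_geometric_tail.
  + by move=> j; rewrite mulr_ge0 ?exponent_majorant_ge0// ltW.
  + by rewrite mulr_ge0// ltW.
  + move=> j _; have := @exponent_majorant_le_linear y (2 ^+ j) (ltW y0) (ltW (p0 j)).
    move=> /(ler_wpM2l (ltW (h0 j))) /le_trans; apply.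
    by rewrite aux1 hp mulr1.
  + move=> j; have : exponent_majorant y (2 ^+ (m.+1 + j)) <= 3.
      by apply: exponent_majorant_le_cst; rewrite addSn exprn_egt1// ltr1n.
    move=> /(ler_wpM2l (ltW (h0 (m.+1 + j)%N))) /le_trans; apply.
    rewrite addSn exprS exprD.
    have := ler_wpM2r (ltW (h0 j)) ylb.
    have : 0 <= 2^-1 ^+ m * 2^-1 ^+ j :> R by rewrite mulr_ge0// ltW.
    by lra.
- under eq_eseriesr do rewrite -EFinM.
  apply: (@le_trans _ _ (m%:R * (3 * y) + 2 * y)%:E); last first.
    rewrite lee_fin lerD2r; have : 0 <= y * m%:R by rewrite mulr_ge0// ltW.
    lra.
  apply: nneseries_le_geometric_tail.
  + by move=> j; rewrite mulr_ge0 ?exponent_majorant_ge0// ltW.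
  + by rewrite ltW.
  + move=> j _; have := @exponent_majorant_le_linear y (2^-1 ^+ j.+1) (ltW y0) (ltW (h0 _)).
    move=> /(ler_wpM2l (ltW (p0 j.+1))) /le_trans; apply.
    by rewrite aux1 [X in _ * X]mulrC hp mulr1.
  + move=> j; set n := (m + j)%N.
    have : exponent_majorant y (2^-1 ^+ n.+1) <= 2 * (y * 2^-1 ^+ n.+1) ^+ 2.
      by apply: exponent_majorant_le_quadratic; rewrite exprn_ile1// invf_le1// ler1n.
    move=> /(ler_wpM2l (ltW (p0 n.+1))) /le_trans; apply.
    rewrite aux2 hp mulr1 exprS /n exprD.
    have yh : y * 2^-1 ^+ m <= 1.
      by rewrite -[leRHS](hp m) mulrC ler_wpM2l// ltW.
    have := ler_wpM2l (ltW (mulr_gt0 y0 (h0 j))) yh.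
    by lra.
Qed.

Lemma norm_Rintegral_le_majorant (k : int) (f : R -> R) (y := (2 : R) ^ (- k)) :
  measurable_fun [set: R] f -> (forall x, `|f x| <= exponent_majorant y x) ->
  `|Rintegral phi `]0, +oo[ f| <= 11 * y * (`|k|%N%:R + 1).
Proof.
move=> mf fle.
have mD : measurable (`]0, +oo[%classic : set R) by [].
have mfD : measurable_fun (`]0, +oo[%classic : set R) f by exact: measurable_funS mf.
have le : (\int[phi]_(x in `]0%R, +oo[) `|f x|%:E <= (11 * y * (`|k|%N%:R + 1))%:E)%E.
  apply: le_trans (integral_exponent_majorant_le k).
  apply: ge0_le_integral => //.
  - apply/measurable_EFinP.
    exact: (@measurableT_comp _ _ _ _ _ _ (fun z : R => `|z|)).
  - by apply/measurable_EFinP; apply: measurable_funS (measurable_exponent_majorant _).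
  - by move=> x _; rewrite lee_fin fle.
(* Integrability excludes the default value of [Rintegral]. *)
have fin : phi.-integrable `]0, +oo[%classic (EFin \o f).
  apply/integrableP; split; first exact/measurable_EFinP.
  by apply: le_lt_trans le _; rewrite ltry.
rewrite -lee_fin EFin_normr_Rintegral//; apply: le_trans le.
by apply: le_abse_integral => //; exact/measurable_EFinP.
Qed.

Lemma Re_levy_exponent_bound (k : int) (y := (2 : R) ^ (- k)) :
  `|complex.Re (levy_exponent phi y)| <= 11 * y * (`|k|%N%:R + 1).
Proof.
rewrite Re_levy_exponentE; apply: norm_Rintegral_le_majorant.
  by apply: measurable_funB => //; exact: measurable_cos_mul.
by move=> x; rewrite distrC ger0_norm ?one_sub_cos_ge0// lerDl.
Qed.

Lemma Im_levy_exponent_bound (k : int) (y := (2 : R) ^ (- k)) :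
  `|complex.Im (levy_exponent phi y)| <= 11 * y * (`|k|%N%:R + 1).
Proof.
rewrite Im_levy_exponentE; apply: norm_Rintegral_le_majorant.
  exact: measurable_compensated_sin.
by move=> x; rewrite lerDr one_sub_cos_ge0.
Qed.

End levy_exponent_bound.

(** * Tails and oscillations of the process *)

Section tail_bound.
Context {R : realType} {d : measure_display} {T : measurableType d}.
Variable P : probability T R.

(** Write the left side as (1 - e^a) + e^a (1 - cos b), with e^a at most 1. *)
Lemma one_sub_expR_cos_le (a b : R) : a <= 0 -> 1 - expR a * cos b <= - a + `|b|.
Proof.
move=> a0; have h := one_sub_cos_le_norm b; have c0 := one_sub_cos_ge0 b.
have e1 : expR a <= 1 by rewrite -expR0 ler_expR.
have := ler_wpM2r c0 e1; have := expR_ge1Dx a.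
lra.
Qed.

Lemma measurable_cos_comp (Z : T -> R) (y : R) : measurable_fun setT Z ->
  measurable_fun setT (fun w => cos (y * Z w)).
Proof.
move=> mZ; apply: (@measurableT_comp _ _ _ _ _ _ (fun x => cos (y * x))) => //.
exact: measurable_cos_mul.
Qed.

Lemma integral_one_sub_cos (Z : T -> R) (y : R) : measurable_fun setT Z ->
  (\int[P]_w (1 - cos (y * Z w))%:E = (1 - complex.Re (char_fun P Z y))%:E)%E.
Proof.
move=> mZ.
have mcos := measurable_cos_comp y mZ.
have icos : P.-integrable setT (EFin \o (fun w => cos (y * Z w))).
  apply: (@le_integrable _ _ _ P setT measurableT _ (cst 1%:E)).
  - exact/measurable_EFinP.
  - by move=> w _ /=; rewrite lee_fin normr1 cos_max.
  - exact: finite_measure_integrable_cst.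
have -> : complex.Re (char_fun P Z y) = Rintegral P setT (fun w => cos (y * Z w)).
  apply: eq_Rintegral => w _; rewrite /cexp /=.
  by rewrite !(mul0r, mul1r, mulr0, oppr0, add0r, addr0) expR0 mul1r.
have i1 : P.-integrable setT (EFin \o (fun=> 1 : R)).
  exact: finite_measure_integrable_cst.
under eq_integral do rewrite EFinB.
rewrite integralB// integral_cst//.
rewrite [X in (_ * X)%E](_ : _ = 1%E); last exact: probability_setT.
rewrite mule1 EFinB.
congr (_ - _)%E; rewrite /Rintegral fineK//.
exact: integrable_fin_num.
Qed.

(** Take the least [l] with |z| <= 2^(a+l+1). The lower bound comes from minimality, or from the
    hypothesis when [l] is 0. *)
Lemma exists_dyadic_scale (a : int) (z : R) : 2 ^ a <= `|z| ->
  exists l : nat, 1 <= `|2 ^ (- (a + l%:Z)) * z| <= 2.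
Proof.
move=> az.
have p0 (k : int) : 0 < (2 : R) ^ k by rewrite exprz_gt0.
have ex : exists l : nat, `|z| <= 2 ^ (a + l.+1%:Z).
  have /archi_boundP : 0 <= `|z| / 2 ^ a by rewrite divr_ge0// ltW.
  set n := Num.bound _ => /ltW h; exists n.
  rewrite expfzDr ?pnatr_eq0// mulrC -ler_pdivrMr//.
  apply: (le_trans h); rewrite -[leRHS]/(2 ^+ n.+1) -natrX ler_nat.
  by rewrite (leq_trans (ltnW (ltn_expl n (isT : (1 < 2)%N))))// leq_exp2l.
case: (ex_minnP ex) => l hl lmin; exists l.
rewrite normrM (ger0_norm (ltW (p0 _))) -invr_expz mulrC.
rewrite ler_pdivlMr// ler_pdivrMr// mul1r; apply/andP; split; last first.
  by move: hl; rewrite intS addrCA expfzDr ?pnatr_eq0// expr1z.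
case: l lmin {hl} => [|l] lmin; first by rewrite addr0.
by rewrite leNgt; apply/negP => /ltW/lmin; rewrite ltnn.
Qed.

Lemma sum_arith_geometric_le (b : R) (N : nat) : 0 <= b ->
  \sum_(0 <= l < N) (b + l%:R) * (2^-1) ^+ l <= 2 * b + 2.
Proof.
move=> b0.
suff -> : \sum_(0 <= l < N) (b + l%:R) * (2^-1) ^+ l
    = 2 * b + 2 - (2 * b + 2 * N%:R + 2) * 2^-1 ^+ N.
  by rewrite gerBl mulr_ge0 ?exprn_ge0 ?invr_ge0// !addr_ge0// mulr_ge0.
elim: N => [|N IH]; first by rewrite big_nil expr0; ring.
by rewrite big_nat_recr//= IH exprS -natr1; field.
Qed.

(** Here 88 = 22 * 4, where 22 is the constant for the characteristic function and 4 comes from 2 b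
    + 2 <= 4 b with b = |a| + 1; the denominator is the least value of the detected term. *)
Definition tail_const : R := 88 / (1 - cos 1).

Lemma tail_const_ge0 : 0 <= tail_const.
Proof. by rewrite divr_ge0// one_sub_cos_ge0. Qed.

(** Sum 1 - cos(2^-(a+l) Z) over [l]: on the event some term is at least 1 - cos 1, while the mean
    of the sum is controlled by an arithmetic-geometric series. *)
Lemma tail_le (Z : T -> R) (t : R) (a : int) : measurable_fun setT Z -> 0 <= t ->
  (forall k : int,
    1 - complex.Re (char_fun P Z (2 ^ (- k))) <= 22 * t * 2 ^ (- k) * (`|k|%N%:R + 1)) ->
  (P [set w | (2 ^ a <= `|Z w|)%R] <= (tail_const * t * 2 ^ (- a) * (`|a|%N%:R + 1))%:E)%E.
Proof.
move=> mZ t0 hk; set A := [set w | _].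
have mA : measurable A.
  rewrite (_ : A = setT `&` (fun w => `|Z w|) @^-1` `[2 ^ a, +oo[%classic).
    apply: (@measurableT_comp _ _ _ _ _ _ (fun z : R => `|z|)) => //.
  by apply/seteqP; split => w /=; rewrite /A in_itv/= andbT// => -[].
have c0 := one_sub_cos1_gt0 R.
pose f l w := (1 - cos (2 ^ (- (a + l%:Z)) * Z w))%:E.
have f0 l w : (0 <= f l w)%E by rewrite lee_fin one_sub_cos_ge0.
have mf l : measurable_fun setT (f l).
  apply/measurable_EFinP; apply: measurable_funB => //; exact: measurable_cos_comp.
have h1 : ((1 - cos 1)%:E * P A <= \int[P]_w \sum_(0 <= l <oo) f l w)%E.
  have mS : measurable_fun setT (fun w => \sum_(0 <= l <oo) f l w)%E.
    by apply: ge0_emeasurable_sum.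
  apply: (@le_trans _ _ (\int[P]_(w in A) \sum_(0 <= l <oo) f l w)%E); last first.
    apply: ge0_subset_integral => //.
    by move=> w _; apply: nneseries_ge0.
  rewrite -integral_cst//; apply: ge0_le_integral => //.
  - by move=> w _; rewrite lee_fin ltW.
  - by apply: measurable_funS mS.
  - move=> w /exists_dyadic_scale[l hl].
    apply: (@le_trans _ _ (f l w)); first by rewrite lee_fin one_sub_cos_ge.
    apply: le_trans (nneseries_lim_ge l.+1 _); last by [].
    by rewrite big_nat_recr//= leeDr// sume_ge0.
have h2 : (\int[P]_w \sum_(0 <= l <oo) f l w <=
    (88 * t * 2 ^ (- a) * (`|a|%N%:R + 1))%:E)%E.
  rewrite integral_nneseries//.
  apply: lime_le.
    by apply: is_cvg_nneseries => n _ _; exact: integral_ge0.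
  apply: nearW => N.
  apply: (@le_trans _ _ (\sum_(0 <= l < N)
      (22 * t * 2 ^ (- a) * ((`|a|%N%:R + 1 + l%:R) * 2^-1 ^+ l))%:E)%E).
    apply: lee_sum => l _; rewrite integral_one_sub_cos// lee_fin.
    apply: (le_trans (hk _)).
    have -> : (2 : R) ^ (- (a + l%:Z)) = 2 ^ (- a) * 2^-1 ^+ l.
      by rewrite opprD expfzDr ?pnatr_eq0// -[2 ^ (- l%:Z)]exprz_inv.
    rewrite [leRHS](_ : _ = 22 * t * (2 ^ (- a) * 2^-1 ^+ l) * (`|a|%N%:R + l%:R + 1)); last by ring.
    rewrite ler_wpM2l//.
      by rewrite !mulr_ge0// ?exprz_ge0// exprn_ge0// invr_ge0.
    by rewrite lerD2r -natrD ler_nat; lia.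
  rewrite sumEFin lee_fin -mulr_sumr.
  have b0 : 0 <= (`|a|%N%:R + 1 : R) by rewrite addr_ge0.
  have := sum_arith_geometric_le N b0.
  have q0 : 0 <= 22 * t * 2 ^ (- a) by rewrite !mulr_ge0// exprz_ge0.
  move=> /(ler_wpM2l q0) /le_trans; apply.
  have := mulr_ge0 q0 (ler0n R `|a|); lra.
have := le_trans h1 h2; rewrite -lee_pdivlMl// => /le_trans; apply.
rewrite -EFinM lee_fin /tail_const le_eqVlt; apply/orP; left; apply/eqP.
by field; rewrite gt_eqF.
Qed.

End tail_bound.

(** * Independence of past and future increments, and Ottaviani's inequality *)

Section ottaviani.
Context {R : realType} {d : measure_display} {T : measurableType d}.
Variable P : probability T R.
Local Open Scope ereal_scope.

(** As functions of [A] both sides are finite measures with the same total mass that agree on a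
    pi-system. *)
Lemma independent_sigma_algebra (G : set (set T)) (W : set T) :
  measurable W -> setI_closed G -> G `<=` measurable ->
  (forall A, G A -> P (A `&` W) = P A * P W) ->
  forall A, <<s G >> A -> P (A `&` W) = P A * P W.
Proof.
move=> mW GI Gm GW A sA.
have p0 : (0 <= fine (P W))%R by rewrite fine_ge0.
pose m1 : {measure set T -> \bar R} := mrestr P mW.
pose m2 : {measure set T -> \bar R} := mscale (NngNum p0) P.
have m2E B : m2 B = P B * P W.
  by rewrite /m2 /= /mscale/= muleC fineK// fin_num_measure.
have HE : [set X | G X /\ X `<=` setT] = G.
  by apply/seteqP; split => [X []|X GX]//; split.
rewrite -m2E -[LHS]/(m1 A).
apply: (g_sigma_algebra_measure_unique_trace G setT) => //; rewrite ?HE//.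
- by rewrite m2E /m1 /= /mrestr setTI (probability_setT P) mul1e.
- by move=> B GB; rewrite m2E; exact: GW.
- by rewrite /m1/= /mrestr setTI (le_lt_trans (probability_le1 P mW))// ltry.
Qed.

(** These generate the events that depend on all variables but the last. The last factor is made
    trivial rather than dropped, so that the product rule applies with the same index type. *)
Definition cylinders n (Z : 'I_n.+1 -> T -> R) : set (set T) :=
  [set A | exists2 B : 'I_n.+1 -> set R,
    (forall i, measurable (B i)) /\ B ord_max = setT &
    A = \bigcap_(i in [set: 'I_n.+1]) (Z i @^-1` B i)].

Lemma cylinders_setI n (Z : 'I_n.+1 -> T -> R) : setI_closed (cylinders Z).
Proof.
move=> _ _ [B [mB BT] ->] [C [mC CT] ->]; exists (fun i => B i `&` C i).
  by split=> [i|]; [exact: measurableI|rewrite BT CT setTI].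
apply/seteqP; split=> [w [hB hC] i _|w h]; first by split; [exact: hB|exact: hC].
by split=> i _; case: (h i I).
Qed.

Lemma cylinders_measurable n (Z : 'I_n.+1 -> T -> R) :
  (forall i, measurable_fun setT (Z i)) -> cylinders Z `<=` measurable.
Proof.
move=> mZ A [B [mB _] ->]; apply: fin_bigcap_measurable => // i _.
by rewrite -[X in measurable X]setTI; exact: mZ.
Qed.

Lemma independent_last n (Z : 'I_n.+1 -> T -> R) (C : set R) :
  (forall i, measurable_fun setT (Z i)) -> mutually_independent P Z ->
  measurable C ->
  forall A, <<s cylinders Z >> A ->
  P (A `&` Z ord_max @^-1` C) = P A * P (Z ord_max @^-1` C).
Proof.
move=> mZ iZ mC; apply: independent_sigma_algebra.
- by rewrite -[X in measurable X]setTI; exact: mZ.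
- exact: cylinders_setI.
- exact: cylinders_measurable.
move=> _ [B [mB BT] ->].
(* The free last slot of the cylinder is filled with [C]. *)
pose B' i := if i == ord_max then C else B i.
have -> : \bigcap_(i in [set: 'I_n.+1]) (Z i @^-1` B i) `&` Z ord_max @^-1` C =
    \bigcap_(i in [set: 'I_n.+1]) (Z i @^-1` B' i).
  apply/seteqP; split=> [w [hB hC] i _|w h]; rewrite /B'/=.
    by case: ifPn => [/eqP ->//|_]; exact: hB.
  split; last by have := h ord_max I; rewrite /B'/= eqxx.
  move=> i _; have := h i I; rewrite /B'/=; case: ifPn => [/eqP -> _|//].
  by rewrite BT.
rewrite !iZ//; last by move=> i; rewrite /B'; case: ifP.
rewrite !big_ord_recr/= BT preimage_setT (probability_setT P) mule1 /B' eqxx.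
congr (_ * _); apply: eq_bigr => i _; case: ifPn => // /eqP /(congr1 val)/= e.
by have := ltn_ord i; rewrite e ltnn.
Qed.

Lemma measurable_cylinders n (Z : 'I_n.+1 -> T -> R) (i : 'I_n.+1) :
  i != ord_max ->
  @measurable_fun _ _ (g_sigma_algebraType (cylinders Z)) R setT (Z i).
Proof.
move=> imax _ B mB; apply: sub_sigma_algebra; rewrite setTI.
exists (fun j => if j == i then B else setT).
  by split=> [j|]; [case: ifP|rewrite eq_sym (negbTE imax)].
apply/seteqP; split=> [w hB j _|w /(_ i I)]; last by rewrite eqxx.
by case: ifPn => // /eqP ->.
Qed.

Variable X : R -> T -> R.
Hypothesis mX : real_process X.
Hypothesis iX : independent_increments P X.

Definition first_passage (t : nat -> R) (v : R) (i : nat) : set T :=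
  [set w | (v <= `|X (t i) w - X (t 0%N) w|)%R /\
     forall l, (l < i)%N -> (`|X (t l) w - X (t 0%N) w| < v)%R].

(** A first passage at [i] is determined by the increments before [t i], and the remaining increment
    is independent of them. *)
Lemma first_passage_independent (t : nat -> R) (v u : R) (i K : nat) :
  (0 <= t 0%N)%R -> (forall l, t l <= t l.+1)%R -> (i <= K)%N ->
  P (first_passage t v i `&` [set w | (u <= `|X (t K) w - X (t i) w|)%R]) =
  P (first_passage t v i) * P [set w | (u <= `|X (t K) w - X (t i) w|)%R].
Proof.
move=> t0 tS iK.
have tle l m : (l <= m)%N -> (t l <= t m)%R.
  elim: m => [|m IH]; first by rewrite leqn0 => /eqP ->.
  rewrite leq_eqVlt => /predU1P[->//|]; rewrite ltnS => /IH /le_trans; exact.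
have tge l : (0 <= t l)%R by rewrite (le_trans t0)// tle.
(* The times [tau] jump from [t i] straight to [t K], so the future is a single increment, the last
   one. *)
pose tau l := if (l <= i)%N then t l else t K.
have taul l : (l <= i)%N -> tau l = t l by rewrite /tau => ->.
have tau_last : tau i.+1 = t K by rewrite /tau ltnn.
have tau0 l : (0 <= tau l)%R by rewrite /tau; case: ifP.
pose Z (l : 'I_i.+1) := increment X (tau l) (tau l.+1).
have iZ : mutually_independent P Z.
  apply: iX => [|l]; first exact: tau0.
  rewrite ltnS leq_eqVlt => /predU1P[->|li].
    by rewrite tau_last taul// tle.
  by rewrite !taul// ltnW.
have mZ l : measurable_fun setT (Z l).
  by apply: measurable_funB; apply: mX; exact: tau0.
have Zmax : Z ord_max = increment X (t i) (t K).
  by rewrite /Z /= tau_last taul.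
have -> : [set w | (u <= `|X (t K) w - X (t i) w|)%R] =
    Z ord_max @^-1` [set x | (u <= `|x|)%R] by rewrite Zmax.
apply: independent_last => //.
  rewrite (_ : [set x | _] = setT `&` (fun z : R => `|z|%R) @^-1` `[u, +oo[%classic).
    by apply: (@normr_measurable R setT).
  by apply/seteqP; split=> x /=; rewrite in_itv/= andbT// => -[].
(* The same sample space with the smaller sigma-algebra of the past; the walk up to [i] is
   measurable for it as a sum of past increments. *)
pose T' := g_sigma_algebraType (cylinders Z).
pose S l (w : T') : R := (X (t l) w - X (t 0%N) w)%R.
have mS l : (l <= i)%N -> measurable_fun setT (S l).
  elim: l => [_|l IH li].
    rewrite (_ : S 0%N = cst 0%R)//.
    by apply/funext => w; rewrite /S subrr.
  have hl : (l < i.+1)%N by rewrite ltnW.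
  rewrite (_ : S l.+1 = S l \+ Z (Ordinal hl))%R; last first.
    apply/funext => w; rewrite /S /Z /increment /= !taul// ?(ltnW li)//.
    by rewrite addrC -addrA [RHS]addrC; ring.
  apply: measurable_funD; first by apply: IH; exact: ltnW.
  by apply: measurable_cylinders; rewrite -val_eqE/= ltn_eqF.
have mnS l : (l <= i)%N -> measurable_fun setT (fun w : T' => `|S l w|%R).
  by move=> li; apply: (@measurableT_comp _ _ _ _ _ _ (fun z : R => `|z|%R)) => //; exact: mS.
have -> : first_passage t v i =
    (setT `&` (fun w : T' => `|S i w|%R) @^-1` `[v, +oo[%classic) `&`
    \bigcap_(l in `I_i) (setT `&` (fun w : T' => `|S l w|%R) @^-1` `]-oo, v[%classic).
  apply/seteqP; split=> w /=.
    move=> [h1 h2]; split; first by split => //=; rewrite in_itv/= andbT.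
    by move=> l /= li; split=> //=; rewrite in_itv/=; exact: h2.
  move=> [[_ h1] h2]; split; first by move: h1; rewrite /= in_itv/= andbT.
  by move=> l li; have [_] := h2 l li; rewrite /= in_itv/=.
suff : @measurable _ T' ((setT `&` (fun w : T' => `|S i w|%R) @^-1` `[v, +oo[%classic) `&`
    \bigcap_(l in `I_i) (setT `&` (fun w : T' => `|S l w|%R) @^-1` `]-oo, v[%classic)) by [].
apply: measurableI; first exact: mnS.
apply: bigcap_measurableType => l /= li.
by apply: mnS => //; exact: ltnW.
Qed.

Lemma measurable_increment (s t : R) : (0 <= s)%R -> (0 <= t)%R ->
  measurable_fun setT (fun w => `|X t w - X s w|%R).
Proof.
move=> s0 t0; apply: (@measurableT_comp _ _ _ _ _ _ (fun z : R => `|z|%R)) => //.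
by apply: measurable_funB; exact: mX.
Qed.

Lemma measurable_increment_ge (s t v : R) : (0 <= s)%R -> (0 <= t)%R ->
  measurable [set w | (v <= `|X t w - X s w|)%R].
Proof.
move=> s0 t0; have := @measurable_increment s t s0 t0 measurableT `[v, +oo[%classic.
rewrite (_ : setT `&` _ = [set w | (v <= `|X t w - X s w|)%R]); first exact.
by apply/seteqP; split=> w /=; rewrite in_itv/= andbT// => -[].
Qed.

Lemma measurable_first_passage (t : nat -> R) v i : (forall l, 0 <= t l)%R ->
  measurable (first_passage t v i).
Proof.
move=> t0.
rewrite (_ : first_passage t v i = [set w | (v <= `|X (t i) w - X (t 0%N) w|)%R] `&`
    \bigcap_(l in `I_i) ~` [set w | (v <= `|X (t l) w - X (t 0%N) w|)%R]).
  apply: measurableI; first exact: measurable_increment_ge.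
  apply: bigcap_measurableType => l _.
  by apply: measurableC; exact: measurable_increment_ge.
apply/seteqP; split=> w [h1 h2]; split=> //.
  by move=> l /= li; apply/negP; rewrite -ltNge; exact: h2.
by move=> l li; rewrite ltNge; apply/negP; exact: h2.
Qed.

(* Ottaviani's inequality: after the first passage above [2 v], an increment
   smaller than [v] keeps the walk above [v]. *)
Lemma ottaviani_inequality (t : nat -> R) (v : R) (K : nat) (p : \bar R) :
  (0 <= t 0%N)%R -> (forall l, t l <= t l.+1)%R -> 0 <= p ->
  (forall i, (i <= K)%N -> P [set w | (v <= `|X (t K) w - X (t i) w|)%R] <= p) ->
  P [set w | exists2 i, (i <= K)%N & (2 * v <= `|X (t i) w - X (t 0%N) w|)%R] <= p + p.
Proof.
move=> t0 tS p0 hp.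
have tge l : (0 <= t l)%R.
  by elim: l => // l IH; rewrite (le_trans IH).
pose A := first_passage t (2 * v).
pose D i := [set w | (v <= `|X (t K) w - X (t i) w|)%R].
have mA i : measurable (A i) by exact: measurable_first_passage.
have mD i : measurable (D i) by exact: measurable_increment_ge.
set U := [set w | _].
have UE : U = \big[setU/set0]_(i < K.+1) A i.
  rewrite -bigcup_mkord; apply/seteqP; split=> w /=.
    case=> i iK hi.
    have ex : exists i, (2 * v <= `|X (t i) w - X (t 0%N) w|)%R by exists i.
    case: (ex_minnP ex) => m hm minm; exists m.
      by rewrite /= ltnS (leq_trans (minm _ hi)).
    by split => // l lm; rewrite ltNge; apply/negP => /minm; rewrite leqNgt lm.
  by case=> i /= iK [hi _]; exists i.
have mU : measurable U by rewrite UE; exact: bigsetU_measurable.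
have trA : trivIset setT A.
  move=> i j _ _ [w [[hi hi'] [hj hj']]].
  have [ij|ji|//] := ltngtP i j.
    by have := hj' _ ij; rewrite ltNge hi.
  by have := hi' _ ji; rewrite ltNge hj.
have sumA : \sum_(i < K.+1) P (A i) <= 1.
  rewrite -(measure_bigsetU P)// -UE; exact: probability_le1.
(* Either the final position is at distance at least [v] from the start, or the increment after some
   first passage is at least [v]. *)
pose F i := if i is i'.+1 then A i' `&` D i' else D 0%N.
have FU : U `<=` \big[setU/set0]_(i < K.+2) F i.
  rewrite UE -!bigcup_mkord => w [i /= iK Aiw].
  have [h|h] := leP v `|X (t K) w - X (t 0%N) w|%R; first by exists 0%N.
  exists i.+1 => //=; split => //; rewrite /D/=.
  case: Aiw => Aiw _.
  have -> : (X (t K) w - X (t i) w =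
      (X (t K) w - X (t 0%N) w) - (X (t i) w - X (t 0%N) w))%R by ring.
  rewrite distrC; apply: le_trans (lerB_dist _ _).
  by lra.
have : P U <= \sum_(i < K.+2) P (F i).
  apply: (content_subadditive P) => // -[|k] _ /=; first exact: mD.
  exact: measurableI.
move=> /le_trans; apply.
rewrite big_ord_recl/=; apply: leeD; first exact: hp.
(* The first passages are disjoint, so by independence they contribute at most one further [p]. *)
apply: (@le_trans _ _ (\sum_(i < K.+1) P (A i) * p)).
  apply: lee_sum => i _; have iK : (i <= K)%N by rewrite -ltnS.
  have e : P (A i `&` D i) = P (A i) * P (D i) by exact: first_passage_independent.
  apply: (@le_trans _ _ (P (A i `&` D i))); first by [].
  rewrite e.
  by apply: lee_wpmul2l => //; exact: hp.
rewrite -ge0_sume_distrl//.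
by rewrite -[leRHS]mul1e lee_wpmul2r.
Qed.

End ottaviani.

(** * Oscillation of the process over an interval *)

Section levy_oscillation.
Context {R : realType} {d : measure_display} {T : measurableType d}.
Variable P : probability T R.
Variable X : R -> T -> R.

Section increment_tail.
Variable phi : {measure set R -> \bar R}.
Hypothesis phi_supp : phi (~` [set ((2 : R) ^ k)%R | k in [set: int]]) = 0%E.
Hypothesis phi_atom : forall k : int, phi [set ((2 : R) ^ k)%R] = ((2 : R) ^ (- k))%:E.
Hypothesis X_levy : levy_process P X.
Hypothesis X_char : forall t y : R, 0 <= t ->
  char_fun P (X t) y = cexp (t%:C * levy_exponent phi y).

Lemma levy_tail (t : R) (a : int) : 0 <= t ->
  (P [set w | (2 ^ a <= `|X t w|)%R] <=
     (tail_const * t * 2 ^ (- a) * (`|a|%N%:R + 1))%:E)%E.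
Proof.
move=> t0; apply: tail_le => //; first by case: X_levy => mX _ _ _ _; exact: mX.
move=> k; rewrite X_char//.
set psi := levy_exponent phi _.
have -> : complex.Re (cexp (t%:C * psi)) =
    expR (t * complex.Re psi) * cos (t * complex.Im psi).
  by rewrite /cexp; case: psi => u v /=; rewrite !mul0r subr0 addr0.
have hR : `|complex.Re psi| <= 11 * 2 ^ (- k) * (`|k|%N%:R + 1).
  exact: Re_levy_exponent_bound.
have hI : `|complex.Im psi| <= 11 * 2 ^ (- k) * (`|k|%N%:R + 1).
  exact: Im_levy_exponent_bound.
have R0 : complex.Re psi <= 0 by exact: Re_levy_exponent_le0.
apply: (le_trans (one_sub_expR_cos_le _ _)); first by rewrite mulr_ge0_le0.
rewrite normrM (ger0_norm t0) -mulrN -mulrDr.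
(* The factor 22 is 11 for the real part plus 11 for the imaginary part. *)
rewrite [leRHS](_ : _ = t * (2 * (11 * 2 ^ (- k) * (`|k|%N%:R + 1)))); last by ring.
by rewrite ler_wpM2l//; move: hR hI; rewrite (ler0_norm R0); lra.
Qed.

Lemma increment_tail (s h : R) (a : int) : 0 <= s -> 0 <= h ->
  (P [set w | (2 ^ a <= `|X (s + h) w - X s w|)%R] <=
     (tail_const * h * 2 ^ (- a) * (`|a|%N%:R + 1))%:E)%E.
Proof.
move=> s0 h0; case: (X_levy) => mX X0 _ sX _.
have mB : measurable [set x : R | 2 ^ a <= `|x|].
  rewrite (_ : [set x | _] = setT `&` (fun z : R => `|z|%R) @^-1` `[2 ^ a, +oo[%classic).
    by apply: (@normr_measurable R setT).
  by apply/seteqP; split=> x /=; rewrite in_itv/= andbT// => -[].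
have := sX s h s0 h0 _ mB.
rewrite -[X in P X = _]/([set w | (2 ^ a <= `|X (s + h) w - X s w|)%R]) => ->.
case: X0 => N [mN PN NX].
have mXh := measurable_increment_ge mX (2 ^ a) (lexx 0) h0.
have mXh' : measurable [set w | (2 ^ a <= `|X h w|)%R].
  have := mX h h0 measurableT _ mB.
  by rewrite setTI.
(* [X 0] vanishes only almost surely; the exceptional null set is joined to the event. *)
apply: (@le_trans _ _ (P ([set w | (2 ^ a <= `|X h w|)%R] `|` N))).
  apply: le_measure; rewrite ?inE//; first exact: measurableU.
  move=> w /= hw; have [Xw|/NX] := pselect (X 0 w = 0); last by right.
  by left; move: hw; rewrite /increment Xw subr0.
by rewrite measureU0//; exact: levy_tail.
Qed.

End increment_tail.

(** Only dyadic times enter, so that the event is measurable; right continuity recovers the other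
    times. The factor 2 is the one in Ottaviani's inequality. *)
Definition oscillation_event (a h v : R) : set T :=
  [set w | exists N i : nat, (i <= 2 ^ N)%N /\
     2 * v <= `|X (a + i%:R * (h / 2 ^+ N)) w - X a w|].

Section oscillation_event_bound.
Hypothesis mX : real_process X.
Hypothesis iX : independent_increments P X.
Variables (a h v : R) (p : \bar R).
Hypothesis a0 : 0 <= a.
Hypothesis h0 : 0 <= h.

Let grid N := [set w | exists2 i, (i <= 2 ^ N)%N &
  2 * v <= `|X (a + i%:R * (h / 2 ^+ N)) w - X (a + 0%:R * (h / 2 ^+ N)) w|].

Let oscillation_eventE : oscillation_event a h v = \bigcup_N grid N.
Proof.
apply/seteqP; split=> w.
  by move=> [N [i [iN hi]]]; exists N => //; exists i => //; rewrite mul0r addr0.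
by move=> [N _ [i iN]]; rewrite mul0r addr0 => hi; exists N, i.
Qed.

Let mesh_ge0 N : 0 <= h / 2 ^+ N.
Proof. by rewrite divr_ge0// exprn_ge0. Qed.

Let time_ge0 N (i : nat) : 0 <= a + i%:R * (h / 2 ^+ N).
Proof. by rewrite addr_ge0// mulr_ge0. Qed.

Let measurable_grid N : measurable (grid N).
Proof.
rewrite (_ : grid N = \bigcup_(i in `I_(2 ^ N).+1)
    [set w | 2 * v <= `|X (a + i%:R * (h / 2 ^+ N)) w - X (a + 0%:R * (h / 2 ^+ N)) w|]).
  by apply: bigcup_measurable => i _; exact: measurable_increment_ge.
by apply/seteqP; split=> w [i iN hi]; exists i.
Qed.

Lemma measurable_oscillation_event : measurable (oscillation_event a h v).
Proof. by rewrite oscillation_eventE; exact: bigcupT_measurable. Qed.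

(** The dyadic grids are nested and Ottaviani's bound does not depend on the mesh, so it passes to
    the increasing union. *)
Lemma oscillation_event_le : (0 <= p)%E ->
  (forall s r : R, 0 <= s -> 0 <= r <= h ->
     (P [set w | (v <= `|X (s + r) w - X s w|)%R] <= p)%E) ->
  (P (oscillation_event a h v) <= p + p)%E.
Proof.
move=> p0 hp; rewrite oscillation_eventE.
have nd : nondecreasing_seq grid.
  apply/nondecreasing_seqP => N; apply/subsetPset => w [i iN hi].
  exists (2 * i)%N; first by rewrite expnS leq_mul2l.
  have -> : (2 * i)%N%:R * (h / 2 ^+ N.+1) = i%:R * (h / 2 ^+ N).
    by rewrite natrM exprS; field; rewrite expf_neq0.
  by move: hi; rewrite !mul0r.
have cv : P \o grid @ \oo --> P (\bigcup_N grid N).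
  by apply: nondecreasing_cvg_mu => //; exact: bigcupT_measurable.
rewrite -(cvg_lim _ cv)//; apply: lime_le; first by apply/cvg_ex; exists (P (\bigcup_N grid N)).
apply: nearW => N /=.
apply: (@ottaviani_inequality _ _ _ P X mX iX (fun i => a + i%:R * (h / 2 ^+ N)) v (2 ^ N) p) => //.
  by move=> l; rewrite lerD2l ler_wpM2r// ler_nat.
move=> i iN.
have -> : a + (2 ^ N)%:R * (h / 2 ^+ N) =
    (a + i%:R * (h / 2 ^+ N)) + (2 ^ N - i)%N%:R * (h / 2 ^+ N).
  by rewrite natrB//; ring.
apply: hp => //; rewrite mulr_ge0//=.
by rewrite mulrA ler_pdivrMr ?exprn_gt0// mulrC ler_wpM2l// -natrX ler_nat leq_subr.
Qed.

End oscillation_event_bound.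

(** The dyadic point next to the right of [t] is within the mesh of [t], and it belongs to the grid
    because [t] lies strictly before [a + h]. *)
Lemma right_continuous_dyadic_bound (f : R -> R) (a h c t : R) : 0 < h ->
  a <= t < a + h -> f s @[s --> t^'+] --> f t ->
  (forall N i : nat, (i <= 2 ^ N)%N -> `|f (a + i%:R * (h / 2 ^+ N)) - f a| <= c) ->
  `|f t - f a| <= c.
Proof.
move=> h0 /andP[at_ th] ft hf; rewrite leNgt; apply/negP => ct.
have gt : `|f s - f a| @[s --> t^'+] --> `|f t - f a|.
  by apply: cvg_norm; apply: cvgB => //; exact: cvg_cst.
have [e /= e0 he] := cvgr_gt _ gt _ ct.
have [N hN] : exists N : nat, h / 2 ^+ N < e.
  have /archi_boundP : 0 <= h / e by rewrite divr_ge0// ltW.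
  set n := Num.bound _ => hn; exists n.
  rewrite ltr_pdivrMr ?exprn_gt0// mulrC -ltr_pdivrMr//.
  by rewrite (lt_le_trans hn)// -natrX ler_nat ltnW// ltn_expl.
have m0 : 0 < h / 2 ^+ N by rewrite divr_gt0// exprn_gt0.
have x0 : 0 <= (t - a) / (h / 2 ^+ N) by rewrite divr_ge0 ?subr_ge0// ltW.
have /andP[i1 i2] := truncn_itv x0.
set i := Num.truncn _ in i1 i2.
have iN : (i.+1 <= 2 ^ N)%N.
  rewrite -(ltr_nat R) (le_lt_trans i1)// ltr_pdivrMr// natrX.
  by rewrite mulrCA divff ?mulr1 ?ltrBlDl// expf_neq0.
(* The successor [i.+1] is taken since the limit is from the right and wants a point strictly after
   [t]. *)
have := hf N i.+1 iN; rewrite leNgt => /negP; apply.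
move: i1 i2; rewrite ler_pdivlMr// ltr_pdivrMr// => i1 i2.
apply: he => /=; last by rewrite -ltrBlDl.
rewrite ltr0_norm; last by rewrite subr_lt0 -ltrBlDl.
by move: i1; rewrite -[i.+1%:R]natr1 mulrDl mul1r; lra.
Qed.

End levy_oscillation.

(** * Covers of graphs *)

Section hausdorff_covers.
Variable R : realType.
Implicit Types (s delta D : R) (A U : set (R * R)) (p q : R * R).

Lemma diam_pow_ge0 s U : (0 <= diam_pow s U)%E.
Proof. by rewrite /diam_pow; case: ifP => // _; exact: poweR_ge0. Qed.

Lemma diam_le U D : (forall p q, U p -> U q -> edist2 p q <= D) ->
  (diam U <= D%:E)%E.
Proof.
by move=> UD; apply: ge_ereal_sup => _ [[p q] [/= Up Uq] <-]; rewrite lee_fin UD.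
Qed.

Lemma diam_pow_le s U D : 0 <= s ->
  (forall p q, U p -> U q -> edist2 p q <= D) -> (diam_pow s U <= (D `^ s)%:E)%E.
Proof.
move=> s0 UD; rewrite /diam_pow; case: ifPn => [_|/set0P[p Up]].
  by rewrite lee_fin powR_ge0.
have : (0%:E <= diam U)%E.
  apply: (@le_trans _ _ (edist2 p p)%:E); first by rewrite lee_fin sqrtr_ge0.
  by apply: ereal_sup_ubound; exists (p, p).
have := diam_le UD; case: (diam U) => // r; rewrite !lee_fin => rD r0.
apply: ge0_ler_powR; rewrite ?nnegrE//.
exact: le_trans rD.
Qed.

Lemma hausdorff_content_ge0 s delta A : (0 <= hausdorff_content s delta A)%E.
Proof.
by apply: le_ereal_inf_tmp => _ [U _ <-]; apply: nneseries_ge0 => n _ _; exact: diam_pow_ge0.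
Qed.

Lemma hausdorff_content_le_finite_cover (I : eqType) (F : I -> set (R * R))
    (ids : seq I) s delta D A : 0 <= s -> 0 <= delta -> D <= delta ->
  (forall x, A x -> exists2 i, i \in ids & F i x) ->
  (forall i p q, F i p -> F i q -> edist2 p q <= D) ->
  (hausdorff_content s delta A <= ((size ids)%:R * D `^ s)%:E)%E.
Proof.
move=> s0 delta0 Ddelta AF FD.
(* Beyond the list the sets are empty, and by the convention in [diam_pow] they cost 0 even for
   [s = 0]. *)
pose U n := nth set0 (map F ids) n.
have UF n : (n < size ids)%N -> forall p q, U n p -> U n q -> edist2 p q <= D.
  move=> nids p q; have i0 : I by case: (ids) nids.
  by rewrite /U (nth_map i0)//; exact: FD.
have U0 n : (size ids <= n)%N -> U n = set0.
  by move=> nids; rewrite /U nth_default// size_map.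
apply: (@le_trans _ _ (\sum_(0 <= n <oo) diam_pow s (U n))%E).
  apply: ereal_inf_lbound; exists U => //; split=> [x /AF[i iids Fix]|n].
    exists (index i ids) => //.
    by rewrite /U (nth_map i) ?index_mem// nth_index.
  have [nids|nids] := ltnP n (size ids).
    by apply: le_trans (diam_le (UF n nids)) _; rewrite lee_fin.
  rewrite U0//; apply: (@le_trans _ _ (diam set0)) => //.
  by apply: diam_le.
apply: (@le_trans _ _
    (\sum_(0 <= n <oo) (if (n < size ids)%N then D `^ s else 0)%:E)%E).
  apply: lee_nneseries => [n _ _|n _]; first exact: diam_pow_ge0.
  case: ifPn => [nids|]; first by apply: diam_pow_le => //; exact: UF.
  by rewrite -leqNgt => nids; rewrite U0// /diam_pow eqxx.
rewrite -[X in (_ <= X%:E)%E]addr0 -[X in (_ <= (_ + X)%:E)%E](mulr0 2).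
apply: nneseries_le_geometric_tail => //.
- by move=> j; case: ifP; rewrite ?powR_ge0.
- by move=> j ->.
- by move=> j; rewrite ltnNge leq_addr/= mul0r.
Qed.

Lemma hausdorff_measure_eq0 s A :
  (forall delta e : R, 0 < delta -> 0 < e -> (hausdorff_content s delta A <= e%:E)%E) ->
  hausdorff_measure s A = 0%E.
Proof.
move=> H; apply/eqP; rewrite eq_le; apply/andP; split.
  apply: ge_ereal_sup => _ [delta /= delta0 <-].
  by apply/lee_addgt0Pr => e e0; rewrite add0e; exact: H.
apply: (le_trans (hausdorff_content_ge0 s 1 A)).
by apply: ereal_sup_ubound; exists 1 => /=.
Qed.

(** A sequence of exponents decreasing to [s0] suffices for the infimum; as it is countable, the
    exceptional null sets of the exponents can be united. *)
Lemma hausdorff_dim_le A (s0 : R) : 0 <= s0 ->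
  (forall n : nat, hausdorff_measure (s0 + n.+1%:R^-1) A = 0%E) ->
  (hausdorff_dim A <= s0%:E)%E.
Proof.
move=> s00 H; apply/lee_addgt0Pr => e e0.
have := archi_boundP (ltW (_ : 0 < e^-1)); rewrite invr_gt0 => /(_ e0).
set n := Num.bound _ => hn.
apply: (@le_trans _ _ (s0 + n.+1%:R^-1)%:E).
  apply: ereal_inf_lbound; exists (s0 + n.+1%:R^-1) => //; split; last exact: H.
  by rewrite addr_ge0.
rewrite -EFinD lee_fin lerD2l -[leRHS]invrK lef_pV2 ?posrE ?invr_gt0//.
by rewrite (le_trans (ltW hn))// ler_nat.
Qed.

Lemma edist2_le p q : edist2 p q <= `|p.1 - q.1| + `|p.2 - q.2|.
Proof.
set a := p.1 - q.1; set b := p.2 - q.2.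
have ab0 : 0 <= `|a| + `|b| by rewrite addr_ge0.
rewrite /edist2 -/a -/b -(ger0_norm ab0) -(sqrtr_sqr (`|a| + `|b|)).
rewrite ler_wsqrtr// -[a ^+ 2]real_normK ?num_real// -[b ^+ 2]real_normK ?num_real//.
by have := mulr_ge0 (normr_ge0 a) (normr_ge0 b); rewrite sqrrD; lra.
Qed.

End hausdorff_covers.

Section graph_cover.
Variable R : realType.
Implicit Types (s t h M : R) (f : R -> R).

Lemma ln2_ge : 2^-1 <= ln 2 :> R.
Proof.
have := @le_ln1Dx R (- 2^-1); rewrite (_ : 1 + - 2^-1 = 2^-1 :> R); last by field.
rewrite lnV ?posrE// lerN2; apply; lra.
Qed.

Lemma log2_lip t t' : 2^-1 <= t -> 2^-1 <= t' -> `|log2 t - log2 t'| <= 4 * `|t - t'|.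
Proof.
have h (u u' : R) : 2^-1 <= u -> 2^-1 <= u' -> log2 u - log2 u' <= 4 * `|u - u'|.
  move=> hu hu'; have u0 : 0 < u by lra.
  have u'0 : 0 < u' by lra.
  have l2 : 0 < ln 2 :> R by apply: lt_le_trans ln2_ge; rewrite invr_gt0.
  rewrite /log2 -mulrBl -ln_div ?posrE// ler_pdivrMr//.
  have e : u / u' = 1 + (u - u') / u' by field; rewrite gt_eqF.
  have hl : ln (u / u') <= (u - u') / u'.
    rewrite e; apply: le_ln1Dx.
    by have := divr_gt0 u0 u'0; rewrite e; lra.
  apply: (le_trans hl); rewrite ler_pdivrMr//.
  apply: (le_trans (ler_norm _)).
  (* The Lipschitz constant 4 comes from the lower bounds 1/2 for [ln 2] and for [u']. *)
  have l1 : 1 <= 4 * ln 2 * u'.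
    have : 2^-1 * 2^-1 <= ln 2 * u' :> R by apply: ler_pM => //; exact: ln2_ge.
    lra.
  have := ler_wpM2l (normr_ge0 (u - u')) l1; lra.
move=> ht ht'; rewrite ler_norml; apply/andP; split; last exact: h.
by rewrite -lerN2 opprK opprB (distrC t) h.
Qed.

(** In units of [h]: 1 for the time coordinate, 2 for the change of [f] divided by [t], 4 M for the
    change of 1/t, and 4 for the logarithm. *)
Definition lip_const M := 7 + 4 * M.

Lemma graph_point_dist (f : R -> R) (y := fun t => t^-1 * (f t - t * log2 t)) M h t t' :
  2^-1 <= t -> 2^-1 <= t' -> `|f t'| <= M -> `|t - t'| <= h ->
  `|f t - f t'| <= h -> edist2 (t, y t) (t', y t') <= lip_const M * h.
Proof.
move=> ht ht' fM tt ff; apply: (le_trans (edist2_le _ _)) => /=.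
have t0 : 0 < t by lra.
have t'0 : 0 < t' by lra.
have iv u : 2^-1 <= u -> 0 < u -> u^-1 <= 2 :> R.
  by move=> hu u0; rewrite -[2]invrK lef_pV2// posrE// invr_gt0.
have -> : y t - y t' = t^-1 * (f t - f t') + f t' * (t' - t) * (t^-1 * t'^-1)
    - (log2 t - log2 t').
  by rewrite /y; field; rewrite !gt_eqF.
have hl := log2_lip ht ht'.
have it0 : 0 <= t^-1 by rewrite invr_ge0 ltW.
have it'0 : 0 <= t'^-1 by rewrite invr_ge0 ltW.
have h1 : `|t^-1 * (f t - f t')| <= 2 * h.
  by rewrite normrM (ger0_norm it0) ler_pM// iv.
have h2 : `|f t' * (t' - t) * (t^-1 * t'^-1)| <= M * h * (2 * 2).
  rewrite !normrM (ger0_norm it0) (ger0_norm it'0) ler_pM ?mulr_ge0//.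
    by rewrite ler_pM// distrC.
  by rewrite ler_pM// iv.
have := ler_normB (t^-1 * (f t - f t') + f t' * (t' - t) * (t^-1 * t'^-1)) (log2 t - log2 t').
have := ler_normD (t^-1 * (f t - f t')) (f t' * (t' - t) * (t^-1 * t'^-1)).
rewrite /lip_const; lra.
Qed.

(** Over each time cell the values of [f] are cut into bands of height [h], starting [r j] bands
    below the value at the left end. The last of the 2 r + 1 bands catches the value at the very
    top, and the last of the 2^n + 1 cells catches time 1. *)
Lemma hausdorff_content_graph (f : R -> R) (y := fun t => t^-1 * (f t - t * log2 t))
    (r : nat -> nat) (n : nat) (h := (2^-1 : R) ^+ n) M s delta :
  0 <= s -> 0 <= M -> lip_const M * h <= delta ->
  (forall t, 2^-1 <= t <= 1 -> `|f t| <= M) ->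
  (forall j t, (j < (2 ^ n).+1)%N -> j%:R * h <= t < j.+1%:R * h ->
     `|f t - f (j%:R * h)| <= (r j)%:R * h) ->
  (hausdorff_content s delta (graph_on y `[2^-1%R, 1%R]) <=
    ((\sum_(j < (2 ^ n).+1) ((r j).*2.+1)%:R) * (lip_const M * h) `^ s)%:E)%E.
Proof.
move=> s0 M0 Lh fM fr.
have h0 : 0 < h by rewrite exprn_gt0// invr_gt0.
have hn : h * 2 ^+ n = 1 by rewrite /h -exprMn mulVf// expr1n.
pose F (ji : nat * nat) : set (R * R) := [set (t, y t) | t in
  [set t : R | [/\ 2^-1 <= t <= 1, ji.1%:R * h <= t < ji.1.+1%:R * h &
    ji.2%:R * h <= f t - f (ji.1%:R * h) + (r ji.1)%:R * h < ji.2.+1%:R * h]]].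
pose ids := [seq (j, i) | j <- iota 0 (2 ^ n).+1, i <- iota 0 (r j).*2.+1].
have -> : \sum_(j < (2 ^ n).+1) ((r j).*2.+1)%:R = (size ids)%:R :> R.
  rewrite size_allpairs_dep sumnE big_map -natr_sum.
  rewrite -[X in iota 0 X]subn0 -/(index_iota _ _) big_mkord; congr _%:R.
  by apply: eq_bigr => j _; rewrite size_iota.
have L0 : 0 <= lip_const M * h.
  by rewrite mulr_ge0 ?(ltW h0)// /lip_const; lra.
apply: (hausdorff_content_le_finite_cover (F := F)) => //.
- exact: (le_trans L0 Lh).
- move=> x [t /=]; rewrite in_itv/= => /andP[t1 t2] <-{x}.
  have /andP[j1 j2] : (Num.truncn (t / h))%:R <= t / h < (Num.truncn (t / h)).+1%:R.
    by apply: truncn_itv; rewrite divr_ge0 ?(ltW h0)//; lra.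
  set j := Num.truncn _ in j1 j2.
  rewrite ler_pdivlMr// in j1; rewrite ltr_pdivrMr// in j2.
  have jn : (j < (2 ^ n).+1)%N.
    rewrite ltnS -(ler_nat R) natrX -(ler_pM2l h0) hn mulrC.
    exact: le_trans t2.
  have := fr j t jn; rewrite j1 j2 => /(_ isT) fj.
  set x := f t - f (j%:R * h) + (r j)%:R * h.
  have x0 : 0 <= x by move: fj; rewrite ler_norml /x; lra.
  have x1 : x <= (r j).*2%:R * h.
    by move: fj; rewrite ler_norml /x -addnn natrD; lra.
  have /andP[i1 i2] : (Num.truncn (x / h))%:R <= x / h < (Num.truncn (x / h)).+1%:R.
    by apply: truncn_itv; rewrite divr_ge0 ?(ltW h0).
  set i := Num.truncn _ in i1 i2.
  rewrite ler_pdivlMr// in i1; rewrite ltr_pdivrMr// in i2.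
  exists (j, i).
    apply/allpairsPdep; exists j, i; split=> //; rewrite mem_iota add0n//.
    by rewrite leq0n/= ltnS -(ler_nat R) -(ler_pM2r h0) (le_trans i1).
  exists t => //=; split; first by rewrite t1 t2.
    by rewrite j1 j2.
  by rewrite i1 i2.
- move=> [j i] p q [t /= [/andP[t1 t2] /andP[j1 j2] /andP[i1 i2]] <-{p}].
  move=> [t' /= [/andP[t'1 t'2] /andP[j'1 j'2] /andP[i'1 i'2]] <-{q}].
  rewrite -!natr1 !mulrDl !mul1r in j2 i2 j'2 i'2.
  apply: graph_point_dist => //; first by apply: fM; rewrite t'1 t'2.
    by rewrite ler_norml; lra.
  by rewrite ler_norml; lra.
Qed.

End graph_cover.

(** * Counting the covering squares *)

Section mean_bounds.
Context {R : realType} {d : measure_display} {T : measurableType d}.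
Variable P : probability T R.
Implicit Types f g : T -> R.

(** Measurability and sign are bundled with the bound so that bounds compose along sums and
    multiples. *)
Definition mean_le f (b : R) := [/\ measurable_fun setT f, forall w, 0 <= f w &
  (\int[P]_w (f w)%:E <= b%:E)%E].

Lemma mean_le_weaken f a b : a <= b -> mean_le f a -> mean_le f b.
Proof. by move=> ab [mf f0 fa]; split=> //; rewrite (le_trans fa)// lee_fin. Qed.

Lemma mean_le_cst (a : R) : 0 <= a -> mean_le (fun=> a) a.
Proof.
move=> a0; split=> //; rewrite integral_cst//.
by rewrite [X in (_ * X)%E](_ : _ = 1%E) ?mule1//; exact: probability_setT.
Qed.

Lemma mean_leD f g a b : mean_le f a -> mean_le g b ->
  mean_le (fun w => f w + g w) (a + b).
Proof.
move=> [mf f0 fa] [mg g0 gb]; split.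
- exact: measurable_funD.
- by move=> w; rewrite addr_ge0.
- under eq_integral do rewrite EFinD.
  rewrite ge0_integralD//; first by rewrite EFinD leeD.
  + by move=> w _; rewrite lee_fin.
  + exact/measurable_EFinP.
  + by move=> w _; rewrite lee_fin.
  + exact/measurable_EFinP.
Qed.

Lemma mean_leZ (c : R) f a : 0 <= c -> mean_le f a ->
  mean_le (fun w => c * f w) (c * a).
Proof.
move=> c0 [mf f0 fa]; split.
- exact: measurable_funM.
- by move=> w; rewrite mulr_ge0.
- under eq_integral do rewrite EFinM.
  rewrite ge0_integralZl_EFin//; first by rewrite EFinM lee_wpmul2l// lee_fin.
  + by move=> w _; rewrite lee_fin.
  + exact/measurable_EFinP.
Qed.

Lemma mean_le_sum (n : nat) (f : 'I_n -> T -> R) (b : 'I_n -> R) :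
  (forall i, mean_le (f i) (b i)) ->
  mean_le (fun w => \sum_(i < n) f i w) (\sum_(i < n) b i).
Proof.
elim: n f b => [|n IH] f b fb.
  rewrite big_ord0; under [X in mean_le X _]funext do rewrite big_ord0.
  exact: mean_le_cst.
rewrite big_ord_recr/=; under [X in mean_le X _]funext do rewrite big_ord_recr/=.
by apply: mean_leD => //; exact: IH.
Qed.

Lemma mean_le_indic (E : set T) (b : R) : measurable E -> (P E <= b%:E)%E ->
  mean_le \1_E b.
Proof.
by move=> mE PE; split=> //; rewrite integral_indic// setIT.
Qed.

Lemma markov_mean_le f b (e : R) : 0 < e -> mean_le f b ->
  (P [set w | (e <= f w)%R] <= (b / e)%:E)%E.
Proof.
move=> e0 [mf f0 fb]; set B := [set w | _].
have mB : measurable B.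
  rewrite (_ : B = setT `&` f @^-1` `[e, +oo[%classic); first exact: mf.
  by apply/seteqP; split=> w /=; rewrite /B/= in_itv/= andbT// => -[].
rewrite mulrC EFinM lee_pdivlMl//; apply: le_trans fb.
rewrite -integral_cst//.
apply: (@le_trans _ _ (\int[P]_(w in B) (f w)%:E)%E).
  apply: ge0_le_integral => //.
  - by move=> w _; rewrite lee_fin ltW.
  - by apply/measurable_EFinP; exact: measurable_funS mf.
apply: ge0_subset_integral => //; first exact/measurable_EFinP.
by move=> w _; rewrite lee_fin.
Qed.

(** The event that [f n] is at least [e] for all [n >= n0] lies in each single such event, so by
    Markov's inequality it is null. Values of [e] of the form 1/(p+1) leave countably many events.
    Arbitrarily fine good scales are all that Hausdorff measure asks for. *)
Lemma ae_frequently_small (f : nat -> T -> R) (K : R) : 0 <= K ->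
  (forall n, mean_le (f n) (K / n.+1%:R)) ->
  {ae P, forall w, forall e : R, 0 < e -> forall n0, exists2 n, (n0 <= n)%N & f n w < e}.
Proof.
move=> K0 fK.
have : {ae P, forall w, forall p n0 : nat,
    exists2 n, (n0 <= n)%N & f n w < p.+1%:R^-1}.
  apply: ae_foralln => p; apply: ae_foralln => n0.
  set e := p.+1%:R^-1; have e0 : 0 < e :> R by rewrite invr_gt0.
  pose A := \bigcap_(n in [set n | (n0 <= n)%N]) [set w | e <= f n w].
  have mB n : measurable [set w | e <= f n w].
    rewrite (_ : [set w | _] = setT `&` f n @^-1` `[e, +oo[%classic).
      by case: (fK n) => mf _ _; exact: mf.
    by apply/seteqP; split=> w /=; rewrite in_itv/= andbT// => -[].
  have mA : measurable A by exact: bigcap_measurableType.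
  exists A; split=> //; last first.
    move=> w /= h n /= n0n; rewrite leNgt; apply/negP => fe.
    by apply: h; exists n.
  apply/eqP; rewrite eq_le measure_ge0 andbT.
  apply/lee_addgt0Pr => u u0; rewrite add0e.
  have q0 : 0 <= K / e / u by rewrite !divr_ge0// ltW.
  have := archi_boundP q0; set m := Num.bound _ => hm.
  pose n := maxn n0 m.
  apply: (@le_trans _ _ (P [set w | (e <= f n w)%R])).
    apply: le_measure; rewrite ?inE//.
    by move=> w; apply; rewrite /= leq_maxl.
  apply: (le_trans (markov_mean_le e0 (fK n))); rewrite lee_fin.
  rewrite mulrAC ler_pdivrMr// [leRHS]mulrC -ler_pdivrMr//.
  by rewrite (le_trans (ltW hm))// ler_nat (leq_trans (leq_maxr n0 m)).
apply: filterS => w h e e0 n0.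
have := archi_boundP (ltW (_ : 0 < e^-1)); rewrite invr_gt0 => /(_ e0).
set p := Num.bound _ => hp; have [n n0n fn] := h p n0; exists n => //.
apply: (lt_le_trans fn).
rewrite -[leRHS]invrK lef_pV2 ?posrE ?invr_gt0//.
by rewrite (le_trans (ltW hp))// ler_nat.
Qed.

End mean_bounds.

Section exponential_vs_polynomial.
Variable R : realType.

(** With u = e n ln 2 / 3 the left side is exp(-u)^3, and exp u >= 1 + u >= c (n+1), since ln 2 / 3
    >= 1/6. The cube beats the two powers of [n] in the mean count and leaves one to spare. *)
Lemma half_pow_powR_le (e : R) : 0 < e -> exists2 c : R, 0 < c &
  forall n : nat, (2^-1 ^+ n) `^ e <= (c * n.+1%:R) ^- 3.
Proof.
move=> e0; pose c : R := Num.min (e / 6) 1.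
have c0 : 0 < c by rewrite lt_min ltr01 divr_gt0.
exists c => // n.
have h0 : 0 < (2^-1 : R) ^+ n by rewrite exprn_gt0// invr_gt0.
rewrite /powR gt_eqF// lnXn ?invr_gt0// lnV ?posrE//.
pose u : R := e * n%:R * ln 2 / 3.
have -> : e * (- ln 2 *+ n) = - (u * 3%:R).
  by rewrite -[_ *+ n]mulr_natr /u; field.
rewrite expRN lef_pV2 ?posrE ?exprn_gt0 ?expR_gt0 ?mulr_gt0//.
rewrite expRM_natr lerXn2r// ?nnegrE ?expR_ge0 ?mulr_ge0 ?(ltW c0)//.
apply: le_trans (expR_ge1Dx _); rewrite -natr1 mulrDr mulr1 addrC.
have c1 : c <= 1 by rewrite /c ge_min lexx orbT.
have c2 : c <= e / 6 by rewrite /c ge_min lexx.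
apply: lerD => //.
have en0 : 0 <= e * n%:R by rewrite mulr_ge0// ltW.
have := ler_wpM2l en0 (ln2_ge R); have := ler_wpM2r (ler0n R n) c2.
by rewrite /u; lra.
Qed.

(** One factor 2^-n cancels the number of cells up to a factor 2; the remaining power of exponent
    [e] absorbs the quadratic count per cell. *)
Lemma cover_weight_le (e C : R) : 0 < e -> 0 <= C -> exists2 K : R, 0 <= K &
  forall n : nat, (2^-1 ^+ n) `^ (1 + e) *
    ((2 ^ n).+1%:R * (3 + 6 * (n.*2%:R * (C * n.+2%:R)))) <= K / n.+1%:R.
Proof.
move=> e0 C0; have [c c0 hc] := half_pow_powR_le e0.
exists ((6 + 48 * C) / c ^+ 3).
  by rewrite divr_ge0 ?exprn_ge0 ?(ltW c0)//; lra.
move=> n; have h0 : 0 < (2^-1 : R) ^+ n by rewrite exprn_gt0// invr_gt0.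
have h1 : (2^-1 : R) ^+ n <= 1 by rewrite exprn_ile1// invf_le1// ler1n.
have hn : (2^-1 : R) ^+ n * 2 ^+ n = 1 by rewrite -exprMn mulVf// expr1n.
rewrite powRD ?(gt_eqF h0) ?implybT// powRr1 ?(ltW h0)//.
set q := _ `^ e; have q0 : 0 <= q by exact: powR_ge0.
have n1 : 1 <= n.+1%:R :> R by rewrite ler1n.
set z : R := n.+1%:R in n1 *.
have -> : n.+2%:R = z + 1 :> R by rewrite natr1.
have -> : n.*2%:R = 2 * (z - 1) :> R by rewrite /z -natr1 -muln2 natrM; ring.
have -> : (2 ^ n).+1%:R = 2 ^+ n + 1 :> R by rewrite -natr1 natrX.
set W := 3 + _.
have W0 : 0 <= W.
  rewrite /W addr_ge0// mulr_ge0// !mulr_ge0//; lra.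
have W1 : 2 * W <= (6 + 48 * C) * z ^+ 2.
  have := mulr_ge0 C0 (sqr_ge0 z).
  have : 1 <= z ^+ 2 by rewrite exprn_ege1.
  by rewrite /W !expr2; lra.
have hW : 2^-1 ^+ n * q * ((2 ^+ n + 1) * W) <= q * (2 * W).
  have aux (a b v V : R) : a * v * ((b + 1) * V) = v * ((a * b + a) * V) by ring.
  by rewrite aux hn ler_wpM2l// ler_wpM2r//; lra.
apply: (le_trans hW); apply: (le_trans (ler_wpM2l q0 W1)).
have z0 : 0 < z by lra.
have K0 : 0 <= (6 + 48 * C) * z ^+ 2 by rewrite mulr_ge0 ?sqr_ge0//; lra.
apply: (le_trans (ler_wpM2r K0 (hc n))); rewrite -/z.
by rewrite le_eqVlt; apply/orP; left; apply/eqP; field; rewrite !gt_eqF.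
Qed.

End exponential_vs_polynomial.

(* [2 ^ k] for the least [k] with [w] outside [E k]: all the smaller events
   occur, and already the last of them accounts for half of [2 ^ k]. *)
Lemma least_missed_event (R : realType) (T : Type) (E : nat -> set T) (w : T) (N : nat) :
  ~ E N w -> exists2 k, ~ E k w &
    (2 ^ k)%:R <= 1 + 2 * \sum_(i < N) 2 ^+ i * \1_(E i) w :> R.
Proof.
move=> EN; have ex : exists k, `[< ~ E k w >] by exists N; apply/asboolP.
case: (ex_minnP ex) => k /asboolP Ek kmin; exists k => //.
have s0 (i : 'I_N) : 0 <= 2 ^+ i * \1_(E i) w :> R.
  by rewrite mulr_ge0// exprn_ge0.
case: k Ek kmin => [|k] Ek kmin.
  by rewrite expn0 lerDl mulr_ge0// sumr_ge0.
have kN : (k < N)%N by apply: kmin; apply/asboolP.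
have Ekw : E k w.
  by apply: contrapT => /asboolP/kmin; rewrite ltnn.
rewrite (bigD1 (Ordinal kN))//= indicE mem_set// mulr1 expnS natrM natrX.
have : 0 <= \sum_(i < N | i != Ordinal kN) 2 ^+ i * \1_(E i) w :> R.
  exact: sumr_ge0.
lra.
Qed.

(** * Vanishing Hausdorff measure of the graph *)

Section graph_of_the_process.
Context {R : realType} {d : measure_display} {T : measurableType d}.
Variable P : probability T R.
Variable X : R -> T -> R.
Variable phi : {measure set R -> \bar R}.
Hypothesis phi_supp : phi (~` [set ((2 : R) ^ k)%R | k in [set: int]]) = 0%E.
Hypothesis phi_atom : forall k : int, phi [set ((2 : R) ^ k)%R] = ((2 : R) ^ (- k))%:E.
Hypothesis X_levy : levy_process P X.
Hypothesis X_char : forall t y : R, 0 <= t ->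
  char_fun P (X t) y = cexp (t%:C * levy_exponent phi y).

Local Notation C := (@tail_const R).

Let mX : real_process X. Proof. by case: X_levy. Qed.
Let iX : independent_increments P X. Proof. by case: X_levy. Qed.

Lemma dyadic_oscillation_event_le (a h : R) (k : int) : 0 <= a -> 0 <= h ->
  (P (oscillation_event X a h (2 ^ k)) <=
    (2 * (C * h * 2 ^ (- k) * (`|k|%N%:R + 1)))%:E)%E.
Proof.
move=> a0 h0; set p := C * h * _ * _.
have p0 : 0 <= p.
  by rewrite !mulr_ge0 ?exprz_ge0 ?tail_const_ge0// addr_ge0.
rewrite mulrDl mul1r EFinD; apply: oscillation_event_le => // s r s0 /andP[r0 rh].
apply: (le_trans (increment_tail phi_supp phi_atom X_levy X_char k s0 r0)).
rewrite lee_fin /p !ler_wpM2r ?addr_ge0 ?exprz_ge0//.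
by rewrite ler_wpM2l// tail_const_ge0.
Qed.

(** The exponent is lowered by 1 so that, with the factor 2 of [oscillation_event], the level is 2^k
    mesh lengths. *)
Definition cell_event (n j k : nat) : set T :=
  oscillation_event X (j%:R * 2^-1 ^+ n) (2^-1 ^+ n) (2 ^ (k%:Z - 1 - n%:Z)).

Let mesh_gt0 n : 0 < (2^-1 : R) ^+ n.
Proof. by rewrite exprn_gt0// invr_gt0. Qed.

Let cell_time_ge0 (n j : nat) : 0 <= j%:R * (2^-1 : R) ^+ n.
Proof. by rewrite mulr_ge0// ltW. Qed.

Lemma measurable_cell_event n j k : measurable (cell_event n j k).
Proof. by apply: measurable_oscillation_event => //; exact: ltW. Qed.

Lemma cell_thresholdE (n k : nat) :
  2 * (2 : R) ^ (k%:Z - 1 - n%:Z) = 2 ^+ k * 2^-1 ^+ n.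
Proof.
rewrite !expfzDr ?pnatr_eq0// -[2 ^ (- n%:Z)]exprz_inv -[2 ^ k%:Z]/(2 ^+ k).
rewrite -[_ ^ n%:Z]/(_ ^+ n) -[2 ^ (-1)]/(2^-1).
by rewrite mulrA (mulrCA 2) divff ?mulr1// pnatr_eq0.
Qed.

(** The mesh divided by the threshold is 2 * 2^-k, and [k <= n.*2] keeps the logarithmic factor
    linear in [n]. *)
Lemma cell_event_le (n j k : nat) : (k <= n.*2)%N ->
  (P (cell_event n j k) <= (8 * C * n.+2%:R * 2^-1 ^+ k)%:E)%E.
Proof.
move=> kn; have h0 := ltW (mesh_gt0 n).
apply: (le_trans (dyadic_oscillation_event_le _ (cell_time_ge0 n j) h0)).
set z := k%:Z - 1 - n%:Z.
have zE : 2^-1 ^+ n * (2 : R) ^ (- z) = 2 * 2^-1 ^+ k.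
  have := cell_thresholdE n k; rewrite -/z -invr_expz => e.
  have -> : (2 ^ z : R) = 2 ^+ k * 2^-1 ^+ n / 2 by rewrite -e; field.
  by rewrite !exprVn; field; rewrite !expf_neq0.
rewrite lee_fin.
have -> : 2 * (C * 2^-1 ^+ n * 2 ^ (- z) * (`|z|%N%:R + 1)) =
    4 * C * 2^-1 ^+ k * (`|z|%N%:R + 1).
  by rewrite -(mulrA C) zE; ring.
have -> : 8 * C * n.+2%:R * 2^-1 ^+ k = 4 * C * 2^-1 ^+ k * (2 * n.+2%:R) by ring.
rewrite ler_wpM2l ?mulr_ge0 ?tail_const_ge0// ?exprn_ge0 ?invr_ge0//.
by rewrite -natrM natr1 ler_nat /z; lia.
Qed.

(** A measurable bound for the number of pieces: if r = 2^k with [k] the least missed level and S is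
    the inner sum, then 2 r + 1 <= 3 r <= 3 + 6 S. *)
Definition cover_count (n : nat) (w : T) : R :=
  \sum_(j < (2 ^ n).+1) (3 + 6 * \sum_(k < n.*2) 2 ^+ k * \1_(cell_event n j k) w).

Lemma mean_cover_count_le (e : R) (n : nat) : 0 < e ->
  mean_le P (fun w => (2^-1 ^+ n) `^ (1 + e) * cover_count n w)
    ((2^-1 ^+ n) `^ (1 + e) *
      ((2 ^ n).+1%:R * (3 + 6 * (n.*2%:R * (8 * C * n.+2%:R))))).
Proof.
move=> e0; apply: mean_leZ; first exact: powR_ge0.
have -> : (2 ^ n).+1%:R * (3 + 6 * (n.*2%:R * (8 * C * n.+2%:R))) =
    \sum_(j < (2 ^ n).+1) (3 + 6 * \sum_(k < n.*2) (8 * C * n.+2%:R)).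
  by rewrite !sumr_const !card_ord !mulr_natl.
apply: mean_le_sum => j; apply: mean_leD; first exact: mean_le_cst.
apply: mean_leZ => //; apply: mean_le_sum => k.
(* The weight 2^k cancels the decay of the probability, so all levels contribute alike. *)
have -> : 8 * C * n.+2%:R = 2 ^+ k * (8 * C * n.+2%:R * 2^-1 ^+ k).
  by rewrite exprVn; field; rewrite expf_neq0.
apply: mean_leZ; first exact: exprn_ge0.
apply: mean_le_indic; first exact: measurable_cell_event.
by apply: cell_event_le; exact: ltnW.
Qed.

Lemma ae_cover_count_small (e : R) : 0 < e ->
  {ae P, forall w, forall u : R, 0 < u -> forall n0, exists2 n, (n0 <= n)%N &
    (2^-1 ^+ n) `^ (1 + e) * cover_count n w < u}.
Proof.
move=> e0; have [K K0 hK] : exists2 K : R, 0 <= K & forall n : nat, (2^-1 ^+ n) `^ (1 + e) *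
    ((2 ^ n).+1%:R * (3 + 6 * (n.*2%:R * (8 * C * n.+2%:R)))) <= K / n.+1%:R.
  by apply: cover_weight_le => //; rewrite mulr_ge0// tail_const_ge0.
apply: (ae_frequently_small K0) => n.
by apply: (mean_le_weaken (hK n)); exact: mean_cover_count_le.
Qed.

(** The interval [0, 2] leaves room for the cell that starts at time 1. At levels 4^m the required
    decay follows from m + 1 <= 2^m. *)
Lemma ae_bounded_oscillation :
  {ae P, forall w, exists m : nat, ~ oscillation_event X 0 2 (2 ^ m.*2%:Z) w}.
Proof.
have K0 : 0 <= 8 * C by rewrite mulr_ge0// tail_const_ge0.
have small m : mean_le P \1_(oscillation_event X 0 2 (2 ^ m.*2%:Z)) (8 * C / m.+1%:R).
  apply: mean_le_indic; first exact: measurable_oscillation_event.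
  apply: le_trans (dyadic_oscillation_event_le _ _ _) _ => //.
  rewrite lee_fin -invr_expz -[2 ^ m.*2%:Z]/(2 ^+ m.*2) absz_nat natr1.
  have key : (2 ^+ m.*2)^-1 * m.*2.+1%:R <= 2 / m.+1%:R :> R.
    rewrite ler_pdivlMr// -mulrA mulrC ler_pdivrMr ?exprn_gt0//.
    rewrite -natrX -!natrM ler_nat.
    by have := ltn_expl m (isT : (1 < 2)%N); rewrite -addnn expnD; nia.
  have aux (a b : R) : 2 * (C * 2 * a * b) = 4 * C * (a * b) by ring.
  have -> : 8 * C / m.+1%:R = 4 * C * (2 / m.+1%:R) by ring.
  by rewrite aux ler_wpM2l// mulr_ge0// tail_const_ge0.
apply: filterS (ae_frequently_small K0 small) => w /(_ 1 ltr01 0%N)[m _].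
by rewrite indicE => h; exists m => /mem_set E; rewrite E ltxx in h.
Qed.

Lemma not_cell_event_bound w n j k (t : R) : cadlag (X^~ w) ->
  ~ cell_event n j k w -> j%:R * 2^-1 ^+ n <= t < j.+1%:R * 2^-1 ^+ n ->
  `|X t w - X (j%:R * 2^-1 ^+ n) w| <= (2 ^ k)%:R * 2^-1 ^+ n.
Proof.
move=> [rc _] nE /andP[t1 t2].
apply: (@right_continuous_dyadic_bound _ (X^~ w) _ (2^-1 ^+ n)) => //.
- by rewrite t1/= (lt_le_trans t2)// -natr1 mulrDl mul1r.
- by apply: rc; rewrite (le_trans _ t1).
move=> N i iN; rewrite natrX -cell_thresholdE leNgt; apply/negP => h.
by apply: nE; exists N, i; split => //; exact: ltW.
Qed.

Lemma not_oscillation_event_bound w (m : nat) (t : R) : cadlag (X^~ w) ->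
  ~ oscillation_event X 0 2 (2 ^ m%:Z) w -> 0 <= t < 2 ->
  `|X t w - X 0 w| <= 2 * 2 ^+ m.
Proof.
move=> [rc _] nE /andP[t1 t2].
apply: (@right_continuous_dyadic_bound _ (X^~ w) _ 2) => //.
- by rewrite t1 add0r.
- exact: rc.
move=> N i iN; rewrite leNgt; apply/negP => h.
by apply: nE; exists N, i; split => //; exact: ltW.
Qed.

(** At [k = n.*2] the level is 2^n, whereas two times before 2 have values at most 4 * 2^m apart,
    which is less than 2^n. The cell stays before time 2 as it starts by 1 and has length at most
    1/2. *)
Lemma eventually_no_cell_event w (m n j : nat) : cadlag (X^~ w) ->
  ~ oscillation_event X 0 2 (2 ^ m%:Z) w -> (m.+3 <= n)%N -> (j < (2 ^ n).+1)%N ->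
  ~ cell_event n j n.*2 w.
Proof.
move=> cw nE mn jn [N [i [iN]]]; apply/negP; rewrite -ltNge cell_thresholdE.
have hn : (2^-1 : R) ^+ n * 2 ^+ n = 1 by rewrite -exprMn mulVf// expr1n.
have h0 := mesh_gt0 n.
have -> : 2 ^+ n.*2 * 2^-1 ^+ n = 2 ^+ n :> R.
  by rewrite -addnn exprD -mulrA [X in _ * X]mulrC hn mulr1.
have jh : j%:R * 2^-1 ^+ n <= 1 :> R.
  by rewrite -[leRHS]hn [leRHS]mulrC ler_wpM2r ?(ltW h0)// -natrX ler_nat.
have hhalf : 2^-1 ^+ n <= 2^-1 :> R.
  case: (n) mn => // n' _; rewrite exprS ler_piMr ?invr_ge0//.
  by rewrite exprn_ile1// invf_le1// ler1n.
have ih : i%:R * (2^-1 ^+ n / 2 ^+ N) <= 2^-1 ^+ n :> R.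
  rewrite mulrCA ler_piMr ?(ltW h0)// ler_pdivrMr ?exprn_gt0// mul1r.
  by rewrite -natrX ler_nat.
have ih0 : 0 <= i%:R * (2^-1 ^+ n / 2 ^+ N) :> R.
  by rewrite mulr_ge0// divr_ge0 ?exprn_ge0// ltW.
have jh0 := cell_time_ge0 n j.
set s := j%:R * 2^-1 ^+ n in jh jh0 *.
set t := s + _.
have b1 : `|X s w - X 0 w| <= 2 * 2 ^+ m.
  by apply: not_oscillation_event_bound => //; rewrite jh0/=; lra.
have b2 : `|X t w - X 0 w| <= 2 * 2 ^+ m.
  by apply: not_oscillation_event_bound => //; rewrite /t; apply/andP; split; lra.
have pm : 0 < (2 : R) ^+ m by rewrite exprn_gt0.
have mn2 : 2 ^+ m.+3 <= 2 ^+ n :> R by rewrite ler_weXn2l// ler1n.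
have := ler_distD (X 0 w) (X t w) (X s w).
rewrite (distrC (X 0 w)); move: mn2; rewrite !exprS; lra.
Qed.

Lemma hausdorff_measure_graph_eq0 w (m : nat) (e : R) : 0 < e -> cadlag (X^~ w) ->
  ~ oscillation_event X 0 2 (2 ^ m%:Z) w ->
  (forall u : R, 0 < u -> forall n0, exists2 n, (n0 <= n)%N &
    (2^-1 ^+ n) `^ (1 + e) * cover_count n w < u) ->
  hausdorff_measure (1 + e) (graph_on (fun t => Y_of X t w) `[2^-1%R, 1%R]) = 0%E.
Proof.
move=> e0 cw nE small; apply: hausdorff_measure_eq0 => delta u delta0 u0.
pose M := `|X 0 w| + 2 * 2 ^+ m.
have M0 : 0 <= M by rewrite addr_ge0// mulr_ge0// exprn_ge0.
set L := lip_const M; have L0 : 0 < L by rewrite /L /lip_const; lra.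
have s0 : 0 <= 1 + e by lra.
have Ls : 0 < L `^ (1 + e) by exact: powR_gt0.
have := archi_boundP (divr_ge0 (ltW L0) (ltW delta0)).
set n1 := Num.bound _ => hn1.
(* The scale [n] is past [n1], so that the pieces are smaller than [delta], and past [m.+3], so that
   each cell misses its top event; the division by L^(1+e) offsets the Lipschitz constant. *)
have [n nn hn] := small (u / L `^ (1 + e)) (divr_gt0 u0 Ls) (maxn n1 m.+3).
have n1n : (n1 <= n)%N by rewrite (leq_trans _ nn)// leq_maxl.
have mn : (m.+3 <= n)%N by rewrite (leq_trans _ nn)// leq_maxr.
have h0 := mesh_gt0 n.
have hn2 : (2^-1 : R) ^+ n * 2 ^+ n = 1 by rewrite -exprMn mulVf// expr1n.
have Lh : L * 2^-1 ^+ n <= delta.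
  rewrite exprVn ler_pdivrMr ?exprn_gt0// mulrC -ler_pdivrMr//.
  rewrite (le_trans (ltW hn1))// -natrX ler_nat (leq_trans n1n)//.
  by rewrite ltnW// ltn_expl.
have /choice[r hr] : forall j : nat, exists r : nat, (j < (2 ^ n).+1)%N ->
    (forall t : R, j%:R * 2^-1 ^+ n <= t < j.+1%:R * 2^-1 ^+ n ->
       `|X t w - X (j%:R * 2^-1 ^+ n) w| <= r%:R * 2^-1 ^+ n) /\
    r.*2.+1%:R <= 3 + 6 * \sum_(k < n.*2) 2 ^+ k * \1_(cell_event n j k) w :> R.
  move=> j; have [jn|_] := boolP (j < (2 ^ n).+1)%N; last by exists 0%N.
  have [k nk hk] := least_missed_event R (eventually_no_cell_event cw nE mn jn).
  exists (2 ^ k)%N => _; split=> [t|]; first exact: not_cell_event_bound.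
  have : 1 <= (2 ^ k)%:R :> R by rewrite ler1n expn_gt0.
  by rewrite -natr1 -addnn natrD; move: hk; lra.
have fM (t : R) : 2^-1 <= t <= 1 -> `|X t w| <= M.
  move=> /andP[t1 t2]; have : `|X t w - X 0 w| <= 2 * 2 ^+ m.
    by apply: not_oscillation_event_bound => //; apply/andP; split; lra.
  have := ler_normD (X t w - X 0 w) (X 0 w); rewrite subrK /M; lra.
have fr (j : nat) (t : R) : (j < (2 ^ n).+1)%N ->
    j%:R * 2^-1 ^+ n <= t < j.+1%:R * 2^-1 ^+ n ->
    `|X t w - X (j%:R * 2^-1 ^+ n) w| <= (r j)%:R * 2^-1 ^+ n.
  by move=> jn; have [h _] := hr j jn; exact: h.
apply: (le_trans (@hausdorff_content_graph _ (X^~ w) r n M (1 + e) delta s0 M0 Lh fM fr)).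
rewrite lee_fin powRM ?(ltW L0) ?(ltW h0)//.
have : \sum_(j < (2 ^ n).+1) (r j).*2.+1%:R <= cover_count n w.
  by apply: ler_sum => j _; have [_] := hr j (ltn_ord j).
move=> /(ler_wpM2r (mulr_ge0 (ltW Ls) (powR_ge0 (2^-1 ^+ n) (1 + e)))) /le_trans; apply.
apply: ltW; move: hn; rewrite ltr_pdivlMr//.
have aux (a b v : R) : a * (b * v) = v * a * b by ring.
by rewrite aux.
Qed.

End graph_of_the_process.

Theorem theorem2p5 (R : realType) (d : measure_display) (T : measurableType d)
    (P : probability T R) (phi : {measure set R -> \bar R}) (X : R -> T -> R)
    (phi_supp : phi (~` [set (2 : R) ^ k | k in [set: int]]) = 0%E)
    (phi_atom : forall k : int, phi [set (2 : R) ^ k] = ((2 : R) ^ (- k))%:E)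
    (X_levy : levy_process P X)
    (X_char : forall t y : R, 0 <= t ->
       char_fun P (X t) y = cexp (t%:C * levy_exponent phi y)) :
  {ae P, forall w,
     (hausdorff_dim (graph_on (fun t => Y_of X t w) `[2^-1%R, 1%R]) <= 1)%E}.
Proof.
have X_cadlag : {ae P, forall w, cadlag (X^~ w)} by case: X_levy.
have X_bounded := ae_bounded_oscillation phi_supp phi_atom X_levy X_char.
have X_small : {ae P, forall w, forall q : nat,
    forall u : R, 0 < u -> forall n0, exists2 n, (n0 <= n)%N &
      (2^-1 ^+ n) `^ (1 + q.+1%:R^-1) * cover_count X n w < u}.
  apply: ae_foralln => q.
  by apply: (ae_cover_count_small phi_supp phi_atom X_levy X_char); rewrite invr_gt0.
apply: filterS3 X_cadlag X_bounded X_small => w cw [m nE] small.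
apply: hausdorff_dim_le => // q.
by apply: (hausdorff_measure_graph_eq0 _ cw nE (small q)); rewrite invr_gt0.
Qed.
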